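(* Let $P$ be the transition matrix of the random directed configuration graph associated with the degree sequence $(d_1^+,d_1^-,\dots,d_n^+,d_n^-)$, where all degrees lie in $[\delta,\Delta]$ for constants $2\leqslant\delta\leqslant\Delta$ independent of $n$. Let $\rho=\sqrt{\frac1M\sum_{i=1}^n\frac{d_i^-}{d_i^+}}$ and $\tilde\rho=\max\{\rho,\delta^{-1}\}$. Then for every $\varepsilon>0$, $$\lim_{n\to\infty}\mathbf{P}\big(|\lambda_2|>\tilde\rho+\varepsilon\big)=0,$$ where $\lambda_2$ is the second largest eigenvalue in modulus of $P$.
   Context: For each $n$ (the dependence on $n$ is implicit in the notation), $(d_i^+)_{i\leqslant n}$ and $(d_i^-)_{i\leqslant n}$ are deterministic $n$-tuples of positive integers with $\sum_{i=1}^n d_i^+=\sum_{i=1}^n d_i^-=:M$. There are constants $\delta\geqslant2$ and $\Delta\geqslant\delta$, independent of $n$, such that $\delta\leqslant d_i^\pm\leqslant\Delta$ for all $i$ and all $n$. Directed configuration model: vertex $i\in\{1,\dots,n\}$ carries a set $E^+(i)$ of $d_i^+$ half-edges called heads and a set $E^-(i)$ of $d_i^-$ half-edges called tails; $\sigma$ is a uniformly random bijection from the set of all $M$ heads to the set of all $M$ tails; each head $\mathbf e\in E^+(u)$ with $\sigma(\mathbf e)\in E^-(v)$ yields a directed edge from $u$ to $v$ (loops and multiple edges are allowed). The transition matrix is the $n\times n$ random stochastic matrix $$P(u,v)=\frac{\#\{\mathbf e\in E^+(u):\sigma(\mathbf e)\in E^-(v)\}}{d_u^+}.$$ Its eigenvalues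 are the $n$ complex roots of its characteristic polynomial, counted with multiplicity and ordered by decreasing modulus: $|\lambda_n|\leqslant\dots\leqslant|\lambda_2|\leqslant\lambda_1=1$. The quantities $M,\rho,\tilde\rho,\lambda_2$ depend on $n$. *)

(* Defs.v *)
From HB Require Import structures.
From mathcomp Require Import all_boot all_order all_algebra.
From mathcomp Require Import complex.
From mathcomp Require Import all_classical all_reals all_analysis.

Set Implicit Arguments.
Unset Strict Implicit.
Unset Printing Implicit Defensive.

Import Order.TTheory GRing.Theory Num.Theory.
Import numFieldNormedType.Exports.

Local Open Scope ring_scope.

(* The set of half-edges in which vertex i carries d i half-edges: an element
   is a pair of a vertex i (recovered by tag) and an index in 'I_(d i). *)
Definition half_edges (n : nat) (d : 'I_n -> nat) : finType :=
  {i : 'I_n & 'I_(d i)}.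

Section Model.

Variables (n : nat) (dp dm : 'I_n -> nat).

(* Total matchings of the heads (out-degrees dp) to the tails (in-degrees dm);
   nonempty exactly when the two degree sums agree. *)
Definition matchings : {set {ffun half_edges dp -> half_edges dm}} :=
  [set s : {ffun half_edges dp -> half_edges dm} | `[< bijective s >]].

Variable R : realType.

(* Probability of the event A under the uniform law on matchings. *)
Definition matching_prob
    (A : pred {ffun half_edges dp -> half_edges dm}) : R :=
  #|[set s in matchings | A s]|%:R / #|matchings|%:R.

Definition transition_mx (s : {ffun half_edges dp -> half_edges dm}) : 'M[R]_n :=
  \matrix_(u, v)
    (#|[set e : half_edges dp | (tag e == u) && (tag (s e) == v)]|%:R
       / (dp u)%:R).

Definition rho : R :=
  Num.sqrt ((\sum_(i < n) dp i)%N%:R^-1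
              * \sum_(i < n) ((dm i)%:R / (dp i)%:R)).

End Model.

Section Spectrum.

Variables (R : realType) (n : nat) (A : 'M[R]_n).

(* The complex roots of the characteristic polynomial, with multiplicity, by
   decreasing modulus.  The norm of R[i] takes values in R[i], where x <= y
   means that y - x is a nonnegative real; it is total on moduli. *)
Definition eigenvalues : seq R[i] :=
  sort (fun x y => `|y| <= `|x|)
    (sval (closed_field_poly_normal (char_poly (map_mx (real_complex R) A)))).

(* Indexing starts at 0; the value is 0 when n < 2. *)
Definition lambda2 : R[i] := eigenvalues`_1.

End Spectrum.

(* Main.v *)
(** Label the M half-edges on each side, let S be the uniform permutation matrix
    given by the matching, and let B be the M x M matrix of the pairs (tail f,
    head e) carried by a common vertex v, with weight 1/d_v^+.  Up to null
    eigenvalues P is S B, and replacing B by C = B - J/M (J the all-ones matrix),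
    whose row sums vanish, removes exactly one eigenvalue 1.  So the theorem
    says that f(z) = det(1 - z S C) has no zero in a disc slightly smaller than
    |z| < 1/rho~.

    - The coefficient f_k is a signed sum of principal minors of S C.  Averaging
      over transpositions kills all covariances of minors but those of
      neighbouring index sets, and the latter are absorbed because C has zero
      row sums; with Cauchy-Binet, an explicit Gram determinant and Maclaurin's
      inequality, E f_k^2 <= (k+1) rho^(2k) for all k.
    - For fixed k, counting closed walks gives E|tr P^k - 1| <= (3k+1) rho~^k
      + O(1/M).
    - By Newton's identities the power sums p_j = tr P^j - 1 (j <= K) control the
      first K coefficients of 1/f.  If f(z) = 0, evaluating at z the product of f
      with the truncation of 1/f gives 1 = O(|z|^K) tail terms, which is
      impossible for large K on the event where f and the p_j are bounded.
      Only finitely many traces, of fixed order, are needed. *)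

Require Import Defs.
From HB Require Import structures.
From mathcomp Require Import all_boot all_order all_fingroup all_algebra.
From mathcomp Require Import complex.
From mathcomp Require Import all_classical all_reals all_analysis.
From mathcomp Require Import ring lra zify.

Set Implicit Arguments.
Unset Strict Implicit.
Unset Printing Implicit Defensive.

Import Order.TTheory GRing.Theory Num.Theory.
Import numFieldNormedType.Exports.

Local Open Scope ring_scope.

(** * Determinants and principal minors *)

(** Traces of fixed order cannot locate one eigenvalue among many, since the contributions may
    cancel, while orders growing like log n meet tangled walks. The moment bound on every
    coefficient of f gets around this: it controls f uniformly in n on discs inside |z| < 1/rho~, so
    that finitely many traces suffice.

    Three radii are used: r = rho~, beta = r + eps/2 and gamma = r + eps. The gap from r to beta
    makes the series of k r^k / beta^k converge, so the weighted sums of |f_k| and |p_j| have bounds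
    A and B, with probability close to 1, that do not depend on K. The gap from beta to gamma makes
    the tail small. Newton's identities bound the coefficients of 1/f in terms of B alone, so K can
    be chosen after A and B, and the size of the graph last. As rho~ depends on n, all these
    constants must be uniform over r in [1/delta, 1].

    The term 1/delta of rho~ comes from closed walks that run q times round a shorter cycle: they
    carry the weights w^q, and for q > 2 the sum of w^q d^- is bounded by N rho^2 max(w)^(q-2), not
    by N rho^q. *)

Section Determinants.
Variable R : comNzRingType.

(** Sylvester's identity: the block matrix with rows [(1, -U)] and [(V, 1)] has two block triangular
    factorisations, one for each diagonal block eliminated. *)
Lemma det_add1_mulmxC m n (U : 'M[R]_(m, n)) (V : 'M[R]_(n, m)) :
  \det (1%:M + U *m V) = \det (1%:M + V *m U).
Proof.
have e1 : block_mx 1%:M (- U) V 1%:M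
    = block_mx 1%:M 0 V 1%:M *m block_mx 1%:M (- U) 0 (1%:M + V *m U).
  rewrite mulmx_block !mul1mx !mulmx1 !mul0mx ?mulmx0 !addr0 mulmxN.
  by rewrite addrC addrK.
have e2 : block_mx 1%:M (- U) V 1%:M
    = block_mx 1%:M (- U) 0 1%:M *m block_mx (1%:M + U *m V) 0 V 1%:M.
  rewrite mulmx_block !mul1mx !mulmx1 ?mul0mx ?mulmx0 ?add0r mulNmx.
  by rewrite addrK.
move: (congr1 determinant e1); rewrite e2 !det_mulmx !det_ublock !det_lblock.
by rewrite !det1 !mul1r !mulr1.
Qed.

(** The principal minor of [A] on [K], written with permutations of the whole index set supported in
    [K]: no enumeration of [K] is needed, and [K] can be moved by permutations. *)
Definition pminor n (A : 'M[R]_n) (K : {set 'I_n}) : R :=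
  \sum_(p : 'S_n | perm_on K p) (-1) ^+ p * \prod_(i in K) A i (p i).

Lemma pminor_det n (A : 'M[R]_n) (K : {set 'I_n}) :
  pminor A K = \det (\matrix_(i, j) if i \in K then A i j else (i == j)%:R).
Proof.
rewrite /determinant (bigID (perm_on K)) /= [X in _ + X]big1 ?addr0 => [|p].
  apply: eq_bigr => p pK; congr (_ * _).
  rewrite [RHS](bigID [in K]) /= [X in _ * X]big1 ?mulr1 => [|i iK].
    by apply: eq_bigr => i iK; rewrite mxE iK.
  by rewrite mxE (negPf iK) (out_perm pK iK) eqxx.
move/subsetPn => [ i ]; rewrite inE => pni iK.
by rewrite (bigD1 i) //= mxE (negPf iK) eq_sym (negPf pni) mul0r mulr0.
Qed.

Lemma coef_det_1BX n (A : 'M[R]_n) k :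
  (\det (1%:M - 'X *: map_mx polyC A))`_k
  = (-1) ^+ k * \sum_(K : {set 'I_n} | #|K| == k) pminor A K.
Proof.
(* Expand by the set [K] of the factors that contribute their ['X] term. Each other factor
   contributes [i == p i], so [K] must contain the support of [p]. *)
have E (p : 'S_n) : \prod_i (1%:M - 'X *: map_mx polyC A) i (p i)
    = \sum_(K : {set 'I_n} | perm_on K p)
        ((-1) ^+ #|K| * \prod_(i in K) A i (p i))%:P * 'X^#|K|.
  under eq_bigr do rewrite !mxE addrC.
  rewrite bigA_distr (bigID (fun K : {set 'I_n} => perm_on K p)) /=. 
  rewrite [X in _ + X]big1 ?addr0 => [|K /subsetPn[ i ]].
    apply: eq_bigr => K pK; rewrite (bigID [in K]) /=.
    rewrite [X in _ * X]big1 ?mulr1 => [|i iK]; last first.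
      by rewrite (negPf iK) (out_perm pK iK) eqxx.
    rewrite (eq_bigr (fun i => (- A i (p i))%:P * 'X)) => [|i iK]; last first.
      by rewrite iK -mulrN -polyCN mulrC.
    by rewrite big_split /= prodr_const -rmorph_prod prodrN.
  rewrite inE => pni iK.
  by rewrite (bigD1 i) //= (negPf iK) eq_sym (negPf pni) mul0r.
rewrite /determinant coef_sum big_distrr /=.
under eq_bigr => p _.
  rewrite E -[(-1) ^+ p](rmorph_sign polyC) mulrC coefMC coef_sum big_distrl /=.
  under eq_bigr => K _ do rewrite coefCM coefXn.
over.
rewrite (exchange_big_dep predT) //= [RHS]big_mkcond /=.
apply: eq_bigr => K _; case: eqP => [<-|neK].
  rewrite eqxx /pminor big_distrr /=; apply: eq_bigr => p _.
  by rewrite mulr1 -mulrA; congr (_ * _); rewrite mulrC.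
move/eqP/negPf: neK => neK; rewrite eq_sym neK big1 // => p _.
by rewrite mulr0 mul0r.
Qed.

(** The matrix of [pminor_det] differs from the identity only in the [k] rows of the image of [c];
    hence it is [1 + U V] with inner dimension [k], and Sylvester's identity shrinks it to size
    [k]. *)
Lemma pminor_image n k (A : 'M[R]_n) (c : 'I_k -> 'I_n) : injective c ->
  pminor A [set c a | a in 'I_k] = \det (\matrix_(a, b) A (c a) (c b)).
Proof.
move=> cI; pose U : 'M[R]_(n, k) := \matrix_(i, a) (i == c a)%:R.
pose V : 'M[R]_(k, n) := \matrix_(a, j) (A (c a) j - (c a == j)%:R).
have UVE : 1%:M + U *m V = \matrix_(i, j)
    if i \in [set c a | a in 'I_k] then A i j else (i == j)%:R.
  apply/matrixP => i j; rewrite !mxE; case: imsetP => [[a _ ->]|ni].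
    rewrite (bigD1 a) //= !mxE eqxx mul1r big1 ?addr0 ?[_ + (_ - _)]addrC ?subrK//.
    by move=> a' na; rewrite !mxE (inj_eq cI) eq_sym (negPf na) mul0r.
  rewrite big1 ?addr0 // => a _; rewrite !mxE.
  by case: eqP => [e|]; rewrite ?mul0r //; case: ni; exists a.
rewrite pminor_det -UVE det_add1_mulmxC; congr (\det _).
apply/matrixP => a b; rewrite !mxE (bigD1 (c b)) //= !mxE eqxx mulr1.
rewrite big1 ?addr0 => [|i ni]; last by rewrite !mxE (negPf ni) mulr0.
by rewrite (inj_eq cI) addrC subrK.
Qed.

Lemma pminor_row_perm n (A : 'M[R]_n) (K : {set 'I_n}) (t : 'S_n) :
  perm_on K t -> pminor (row_perm t A) K = (-1) ^+ t * pminor A K.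
Proof.
move=> tK; rewrite /pminor big_distrr /= (reindex_inj (mulgI t)) /=.
have tKV : perm_on K (t^-1)%g by rewrite perm_onV.
apply: eq_big => [p|p pK].
  apply/idP/idP => h; last exact: perm_onM.
  by rewrite -[p](mulKg t); apply: perm_onM.
rewrite odd_permM signr_addb -mulrA; congr (_ * (_ * _)).
rewrite [RHS](reindex_inj (@perm_inj _ t)) /=.
by apply: eq_big => [i|i _]; rewrite ?(perm_closed _ tK) // mxE permM.
Qed.

Lemma pminor_row_perm_out n (A : 'M[R]_n) (K : {set 'I_n}) (t : 'S_n) :
  {in K, forall i, t i = i} -> pminor (row_perm t A) K = pminor A K.
Proof.
move=> tK; apply: eq_bigr => p _; congr (_ * _).
by apply: eq_bigr => i iK; rewrite mxE tK.
Qed.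

Lemma pminor_conj n (A : 'M[R]_n) (K : {set 'I_n}) (t : 'S_n) :
  pminor (row_perm t (col_perm t A)) K = pminor A (t @: K).
Proof.
rewrite /pminor [RHS](reindex_inj (conjg_inj t)) /=; apply: eq_big => [p|p _].
  apply/fintype.subsetP/fintype.subsetP => h x; rewrite inE.
    rewrite -[x](permKV t) permJ (inj_eq perm_inj) => px.
    by rewrite (mem_imset _ _ (@perm_inj _ t)); apply: h; rewrite inE.
  move=> px; rewrite -(mem_imset _ _ (@perm_inj _ t)); apply: h.
  by rewrite inE permJ (inj_eq perm_inj).
rewrite odd_permJ; congr (_ * _); rewrite big_imset /=; last first.
  by move=> x y _ _; exact: perm_inj.
by apply: eq_bigr => i _; rewrite !mxE permJ.
Qed.

(* Summing over all columns y the determinants with column x replaced by column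
   y gives 0 (zero row sums), and the columns y in K other than x contribute 0. *)
Lemma pminor_sum_col n (A : 'M[R]_n) (K : {set 'I_n}) x : x \in K ->
  (forall i, \sum_j A i j = 0) ->
  pminor A K = - \sum_(y | y \notin K) pminor (col_perm (tperm x y) A) K.
Proof.
move=> xK A0.
pose Mt (y : 'I_n) : 'M[R]_n := \matrix_(i, j)
  if i \in K then A i (if j == x then y else j) else (i == j)%:R.
have M0 : \sum_y \det (Mt y) = 0.
  under eq_bigr do rewrite (expand_det_col _ x).
  rewrite exchange_big /= big1 // => i _.
  rewrite (eq_bigr (fun y => (if i \in K then A i y else (i == x)%:R)
    * cofactor (Mt x) i x)) => [|y _]; last first.
    rewrite mxE eqxx; congr (_ * _); rewrite /cofactor; congr (_ * \det _).
    by apply/matrixP => a b; rewrite !mxE [_ == x]eq_sym (negPf (neq_lift x b)).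
  rewrite -big_distrl /=; case iK: (i \in K); first by rewrite A0 mul0r.
  case: eqP => [ix|_]; first by rewrite ix xK in iK.
  by rewrite big1 ?mul0r.
have Mx : \det (Mt x) = pminor A K.
  rewrite pminor_det; congr (\det _); apply/matrixP => i j; rewrite !mxE.
  by case: (j =P x) => // ->.
have Mout y : y \notin K -> \det (Mt y) = pminor (col_perm (tperm x y) A) K.
  move=> yK; have -> : pminor (col_perm (tperm x y) A) K
    = pminor (\matrix_(i, j) A i (if j == x then y else j)) K.
    apply: eq_bigr => p pK; congr (_ * _); apply: eq_bigr => i iK; rewrite !mxE.
    congr (A i _); have : p i \in K by rewrite perm_closed.
    case: tpermP => [->|->|/eqP/negPf nx _ _]; first by rewrite eqxx.
      by rewrite (negPf yK).
    by rewrite nx.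
  rewrite pminor_det; congr (\det _); apply/matrixP => i j; by rewrite !mxE.
have Min y : y \in K -> y != x -> \det (Mt y) = 0.
  move=> yK yx; rewrite -det_tr; apply: (determinant_alternate yx) => i.
  rewrite !mxE eqxx (negPf yx); case: ifP => // iK.
  by case: eqP => [e|_]; [rewrite e yK in iK|case: eqP => // e; rewrite e xK in iK].
apply/eqP; rewrite -addr_eq0; apply/eqP; rewrite -[RHS]M0 [RHS](bigID [in K]) /=.
rewrite [X in _ = X + _](bigD1 x) //= [X in _ = (_ + X) + _]big1 ?addr0 ?Mx.
  by congr (_ + _); apply: eq_bigr => y yK; rewrite Mout.
by move=> y /andP[yK yx]; rewrite Min.
Qed.

(** The random permutation acts on rows only, so the column replacements produced by the zero row
    sums have to be traded for row swaps, at the price of moving the index set. *)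
Lemma pminor_swap n (A : 'M[R]_n) (K : {set 'I_n}) x y : x \in K -> y \notin K ->
  pminor (col_perm (tperm x y) A) K
  = pminor (row_perm (tperm x y) A) (y |: K :\ x).
Proof.
move=> xK yK; have <- : tperm x y @: K = y |: K :\ x.
  apply/setP => z; rewrite -{1}[z](tpermK x y) (mem_imset _ _ (@perm_inj _ _)).
  rewrite !inE; case: tpermP => [->|->|/eqP/negPf zx /eqP/negPf zy].
  - by rewrite (negPf yK) eqxx orbF; case: eqP => // xy; rewrite -xy xK in yK.
  - by rewrite xK eqxx.
  - by rewrite zy zx.
by rewrite -pminor_conj; congr pminor; apply/matrixP => i j; rewrite !mxE tpermK.
Qed.

End Determinants.

(** * Second moment of the coefficients *)

Section SecondMoment.
Variables (R : realFieldType) (n : nat) (C : 'M[R]_n).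
Hypothesis C0 : forall i, \sum_j C i j = 0.

Let pm (s : 'S_n) K := pminor (row_perm s C) K.
Let cov K I := \sum_s pm s K * pm s I.

Let pm_mul (t s : 'S_n) K : pm (t * s)%g K = pminor (row_perm t (row_perm s C)) K.
Proof. by rewrite /pm row_permM. Qed.

Let pm_out (s : 'S_n) x y (K : {set 'I_n}) :
  x \notin K -> y \notin K -> pm (tperm x y * s)%g K = pm s K.
Proof.
move=> xK yK; rewrite pm_mul pminor_row_perm_out // => i iK.
by rewrite tpermD //; [apply: contraNneq xK => ->|apply: contraNneq yK => ->].
Qed.

(** The row transposition [(x y)] changes the sign of the minor on [K] and leaves the one on [I]
    unchanged; by invariance of the sum, [cov K I] equals its opposite. *)
Let cov_far (K I : {set 'I_n}) x y : x != y -> x \in K -> y \in K ->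
  x \notin I -> y \notin I -> cov K I = 0.
Proof.
move=> xy xK yK xI yI; apply/eqP; rewrite -[_ == 0](mulrn_eq0 _ 2) /=.
rewrite mulr2n {2}/cov (reindex_inj (mulgI (tperm x y))) /= -big_split /=.
rewrite big1 // => s _; rewrite (pm_out _ xI yI) pm_mul pminor_row_perm.
  by rewrite odd_tperm xy expr1 mulN1r mulNr subrr.
apply: fintype.subset_trans (tperm_on x y) _; apply/fintype.subsetP => z.
by rewrite !inE => /orP[] /eqP ->.
Qed.

(* Expand the minor on K = x |: I :\ y along its column x; the invariance of the
   uniform law under (x z) turns each term z <> y into a covariance with I. *)
Let cov_swap (I : {set 'I_n}) x y : y \in I -> x \notin I ->
  cov (x |: I :\ y) I
    <= cov I I - \sum_(z | (z \notin I) && (z != x)) cov (z |: I :\ y) I.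
Proof.
move=> yI xI; have xy : x != y by apply: contraNneq xI => ->.
set K := x |: I :\ y; have xK : x \in K by rewrite !inE eqxx.
have yK : y \notin K by rewrite !inE eq_sym (negPf xy) eqxx.
have KI z : z |: K :\ x = z |: I :\ y.
  apply/setP => i; rewrite !inE; case: (i =P x) => [->|//].
  by rewrite (negPf xI) andbF.
have pmK s : pm s K
    = - \sum_(z | z \notin K) pm (tperm x z * s)%g (z |: I :\ y).
  rewrite {1}/pm (pminor_sum_col xK) => [|i]; last first.
    by under eq_bigr do rewrite mxE; exact: C0.
  congr (- _); apply: eq_bigr => z zK.
  by rewrite pminor_swap // KI -pm_mul.
have yIy : y |: I :\ y = I by rewrite finset.setD1K.
rewrite {1}/cov; under eq_bigr do rewrite pmK (bigD1 y) //= yIy opprD mulrDl mulNr.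
rewrite big_split /= lerD //.
  (* The term [z = y] pairs the minors on [I] of [s] and of its swap, which have the same sum of
     squares over [s]; [(u + v)^2 >= 0] bounds it by [cov I I]. *)
  rewrite sumrN lerNl -subr_ge0 opprK addrC.
  rewrite -(pmulr_rge0 _ (ltr0Sn R 1)) mulrDr.
  rewrite {1}mulr_natl mulr2n {2}/cov (reindex_inj (mulgI (tperm x y))) /=.
  rewrite /cov big_distrr /= -!big_split /= sumr_ge0 // => s _.
  set u := pm _ _; set v := pm _ _.
  have -> : u * u + v * v + 2 * (v * u) = (u + v) ^+ 2 by ring.
  exact: sqr_ge0.
under eq_bigr do rewrite mulNr big_distrl /=.
rewrite sumrN exchange_big /= lerN2 le_eqVlt; apply/orP; left; apply/eqP.
apply: eq_big => [z|z /andP[zI zx]].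
  rewrite !inE negb_or negb_and negbK.
  by case: (z =P y) => [->|]; rewrite ?yI ?andbF //= andbT andbC.
rewrite /cov (reindex_inj (mulgI (tperm x z))) /=; apply: eq_bigr => s _.
by rewrite (pm_out _ xI zI).
Qed.

(** Summing [cov_swap] over the [q] elements [x] outside [I] makes the sum [S] appear on both sides:
    [S <= q cov I I + S - q S]. *)
Let cov_swap_sum (I : {set 'I_n}) y : y \in I ->
  \sum_(x | x \notin I) cov (x |: I :\ y) I <= cov I I.
Proof.
move=> yI; set S := (X in X <= _); set q := #|[predC I]|.
have cII : 0 <= cov I I by apply: sumr_ge0 => s _; rewrite -expr2 sqr_ge0.
have : S <= \sum_(x | x \notin I) (cov I I + cov (x |: I :\ y) I - S).
  apply: ler_sum => x xI; apply: le_trans (cov_swap yI xI) _.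
  by rewrite /S [X in _ <= _ - X](bigD1 x) //= opprD addrA addrK.
rewrite big_split /= big_split /= sumr_const sumrN sumr_const -/S -/q.
case: (posnP q) => [q0 _|q0].
  by rewrite /S big_pred0 // => x; have := card0_eq q0 x; rewrite !inE.
move=> H; have : 0 <= cov I I *+ q - S *+ q by move: H; rewrite addrAC lerDr.
by rewrite -mulrnBl pmulrn_lge0 // subr_ge0.
Qed.

(** For fixed [I], only [K = I] and the sets [K] that exchange one [y] of [I] for an outside [x] can
    contribute. The former gives [cov I I], and each of the [k] choices of [y] at most [cov I I]
    again, whence [k + 1]. *)
Lemma sum_sqr_pminor_le (k : nat) :
  \sum_(s : 'S_n) (\sum_(K : {set 'I_n} | #|K| == k)
      pminor (row_perm s C) K) ^+ 2
  <= k.+1%:R * \sum_(s : 'S_n) \sum_(K : {set 'I_n} | #|K| == k)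
      pminor (row_perm s C) K ^+ 2.
Proof.
under eq_bigr => s _ do rewrite expr2 big_distrlr /=.
rewrite exchange_big /= [X in _ <= _ * X]exchange_big /=.
under eq_bigr => K _ do rewrite exchange_big /=.
rewrite exchange_big /= big_distrr /=; apply: ler_sum => I /eqP cI.
have -> : \sum_s pminor (row_perm s C) I ^+ 2 = cov I I.
  by apply: eq_bigr => s _; rewrite expr2.
rewrite (eq_bigr (fun K => (K == I)%:R * cov I I + \sum_(y in I)
   \sum_(x | x \notin I) (K == x |: I :\ y)%:R * cov K I)) => [|K /eqP cK]; last first.
  rewrite -/(pm _ _) -/(cov K I); case: (K =P I) => [->|KI].
    rewrite mul1r big1 ?addr0 // => y yI; rewrite big1 // => x xI.
    case: eqP => [e|_]; last by rewrite mul0r.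
    by move: xI; rewrite e !inE eqxx.
  rewrite mul0r add0r.
  have [x xK xI] : exists2 x, x \in K & x \notin I.
    apply/subsetPn; apply/negP => KsI; case: KI; apply/eqP.
    by rewrite eqEcard KsI cK cI /=.
  have [->|cn0] := eqVneq (cov K I) 0.
    by rewrite big1 // => y _; rewrite big1 // => z _; rewrite mulr0.
  have Ksub z : z \in K -> z != x -> z \in I.
    move=> zK zx; apply: contraNT cn0 => zI.
    by rewrite (cov_far zx) ?eqxx //.
  have [y yI yK] : exists2 y, y \in I & y \notin K.
    apply/subsetPn; apply/negP => IsK; case: KI; apply/eqP.
    by rewrite eq_sym eqEcard IsK cK cI /=.
  have KE : K = x |: I :\ y.
    apply/eqP; rewrite eqEcard; apply/andP; split.
      apply/fintype.subsetP => z zK; rewrite !inE; case: (z =P x) => //= /eqP zx.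
      by rewrite Ksub // andbT; apply: contraNneq yK => <-.
    rewrite cK cardsU1 !inE (negPf xI) andbF /= -cI (cardsD1 y I) yI.
    by [].
  rewrite (bigD1 y) //= (bigD1 x) //= -KE eqxx mul1r big1 ?addr0 => [|z /andP[zI zx]].
    rewrite big1 ?addr0 // => z /andP[zI zy]; rewrite big1 // => u uI.
    case: eqP => [e|]; rewrite ?mul0r //; case/negP: yK.
    by rewrite e !inE yI [y == z]eq_sym zy orbT.
  case: eqP => [e|]; rewrite ?mul0r //; move: (xK).
  by rewrite e !inE [x == z]eq_sym (negPf zx) (negPf xI) andbF.
rewrite big_split /= (bigD1 I) ?cI //= eqxx mul1r.
rewrite big1 ?addr0 => [|K /andP[_ /negPf->]]; last by rewrite mul0r.
rewrite -addn1 natrD mulrDl mul1r addrC lerD2r exchange_big /=.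
apply: le_trans (_ : \sum_(y in I) cov I I <= _); last first.
  by rewrite sumr_const cI mulr_natl.
apply: ler_sum => y yI; apply: le_trans (cov_swap_sum yI).
rewrite exchange_big /=; apply: ler_sum => x xI.
rewrite (bigD1 (x |: I :\ y)) /=; last first.
  by rewrite cardsU1 !inE (negPf xI) andbF /= -cI (cardsD1 y I) yI.
rewrite eqxx mul1r big1 ?addr0 // => K /andP[_ /negPf->].
by rewrite mul0r.
Qed.
End SecondMoment.

(** * Uniform injections, Cauchy-Binet and Maclaurin *)

Section UniformPermutation.
Variables (n : nat) (I : finType) (e : I -> 'I_n).
Hypothesis eI : injective e.

Let restr (s : 'S_n) : {ffun I -> 'I_n} := [ffun i => s (e i)].
Let fib (f : {ffun I -> 'I_n}) := #|[set s | restr s == f]|.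

Let restr_inj s : injectiveb (restr s).
Proof.
by apply/injectiveP => i j; rewrite !ffunE => /perm_inj /eI.
Qed.

Let fib_le f : (fib f <= (n - #|I|)`!)%N.
Proof.
rewrite /fib; have [->|[s0]] := set_0Vmem [set s | restr s == f].
  by rewrite cards0.
rewrite inE => /eqP fs0.
have <- : #|~: [set e i | i : I]| = (n - #|I|)%N.
  by rewrite cardsCs finset.setCK card_ord card_imset.
rewrite -card_perm -(card_imset _ (mulIg s0^-1)%g); apply: subset_leq_card.
apply/fintype.subsetP => t /imsetP[s]; rewrite inE => /eqP; rewrite -fs0 => /ffunP sf ->.
apply/fintype.subsetP => x; rewrite !inE; apply: contra => /imsetP[i _ ->].
by have := sf i; rewrite !ffunE permM => ->; rewrite permK.
Qed.

(** A nonempty fibre translates into permutations fixing the image of [e], so it has at most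
    [(n - #|I|)!] elements. There are [n ^_ #|I|] injections and the fibres add up to [n!], which
    forces equality in each. *)
Lemma card_perm_restr (f : {ffun I -> 'I_n}) :
  injectiveb f -> #|[set s : 'S_n | [ffun i => s (e i)] == f]| = (n - #|I|)`!.
Proof.
rewrite -/(restr _) -/(fib f); move: f.
have cI : (#|I| <= n)%N by rewrite -[n in X in (_ <= X)%N]card_ord (leq_card e eI).
have H (f : {ffun I -> 'I_n}) : injectiveb f ->
    (fib f <= (n - #|I|)`! ?= iff (fib f == (n - #|I|)`!))%N.
  by move=> _; split; [exact: fib_le|].
have E : (\sum_(f : {ffun I -> 'I_n} | injectiveb f) fib f = n`!)%N.
  rewrite -card_Sn -sum1_card.
  rewrite [RHS](partition_big restr (fun f : {ffun I -> 'I_n} => injectiveb f)) /=.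
    by apply: eq_bigr => f _; rewrite sum1dep_card; apply: eq_card => s; rewrite !inE.
  by move=> s _; exact: restr_inj.
have [_ /esym] := leqif_sum H; rewrite sum_nat_const -[#|_|]cardsE card_inj_ffuns.
by rewrite card_ord ffact_fact // E eqxx => /forall_inP h f /h /eqP.
Qed.

Lemma sum_perm_restr (R : pzRingType) (F : {ffun I -> 'I_n} -> R) :
  \sum_(s : 'S_n) F [ffun i => s (e i)]
  = (n - #|I|)`!%:R * \sum_(f : {ffun I -> 'I_n} | injectiveb f) F f.
Proof.
rewrite (partition_big restr (fun f : {ffun I -> 'I_n} => injectiveb f)) /=; last first.
  by move=> s _; exact: restr_inj.
rewrite big_distrr /=; apply: eq_bigr => f fI.
rewrite (eq_bigr (fun => F f)) => [|s /eqP <-] //.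
rewrite sumr_const -(card_perm_restr fI) mulr_natl; congr (_ *+ _).
by apply: eq_card => s; rewrite !inE.
Qed.
End UniformPermutation.

Section CauchyBinet.
Variables (R : comNzRingType) (m n k : nat) (C : 'M[R]_(m, n)).

(* Cauchy-Binet, with the minors indexed by all column tuples. *)
Lemma sum_sqr_minor_rows (j : 'I_k -> 'I_m) :
  \sum_(c : {ffun 'I_k -> 'I_n}) \det (\matrix_(a, b) C (j a) (c b)) ^+ 2
  = k`!%:R * \det (\matrix_(a, b) \sum_y C (j a) y * C (j b) y).
Proof.
pose D (c : {ffun 'I_k -> 'I_n}) := \det (\matrix_(a, b) C (j a) (c b)).
have Dperm (p : 'S_k) (c : {ffun 'I_k -> 'I_n}) : D [ffun a => c (p a)] = (-1) ^+ p * D c.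
  rewrite /D [RHS]mulrC -odd_permV -det_perm -det_mulmx -col_permE.
  by congr (\det _); apply/matrixP => a b; rewrite !mxE ffunE.
have Dtr c : D c = \sum_(p : 'S_k) (-1) ^+ p * \prod_a C (j (p a)) (c a).
  rewrite /D -det_tr; apply: eq_bigr => p _; congr (_ * _).
  by apply: eq_bigr => a _; rewrite !mxE.
(* Expand one of the two determinants only; after reindexing [c] by [p] the signs cancel, and all
   [k!] terms are equal. *)
transitivity (\sum_(p : 'S_k) \sum_(c : {ffun 'I_k -> 'I_n}) (\prod_a C (j a) (c a)) * D c).
  under eq_bigr => c _ do rewrite expr2 {1}/determinant big_distrl /=.
  rewrite exchange_big /=; apply: eq_bigr => p _.
  have cK : {on predT, bijective (fun c : {ffun 'I_k -> 'I_n} => [ffun a => c (p a)])}.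
    exists (fun c => [ffun a => c ((p^-1)%g a)]) => c _; apply/ffunP => a.
      by rewrite !ffunE permKV.
    by rewrite !ffunE permK.
  rewrite [RHS](reindex _ cK) /=; apply: eq_bigr => c _.
  rewrite Dperm -/(D c) mulrCA mulrA; congr (_ * _ * _).
  by apply: eq_bigr => a _; rewrite mxE ffunE.
rewrite sumr_const cardT -cardE card_Sn mulr_natl; congr (_ *+ _).
rewrite -[RHS]det_tr; under eq_bigr => c _ do rewrite Dtr big_distrr /=.
rewrite exchange_big /=; apply: eq_bigr => p _.
under eq_bigr => c _ do rewrite mulrCA -big_split /=.
rewrite -big_distrr /=; congr (_ * _).
rewrite -(bigA_distr_bigA (fun a y => C (j a) y * C (j (p a)) y)).
by apply: eq_bigr => a _; rewrite !mxE; apply: eq_bigr => y _; rewrite mulrC.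
Qed.
End CauchyBinet.

Section InjectiveTuples.
Variables (T : finType) (R : comNzRingType).

Lemma sum_inj_image (k : nat) (F : {set T} -> R) :
  \sum_(c : {ffun 'I_k -> T} | injectiveb c) F [set c a | a in 'I_k]
  = k`!%:R * \sum_(K : {set T} | #|K| == k) F K.
Proof.
rewrite (partition_big (fun c : {ffun 'I_k -> T} => [set c a | a in 'I_k])
  (fun K : {set T} => #|K| == k)) /=; last first.
  by move=> c /injectiveP cI; rewrite card_imset // card_ord.
rewrite big_distrr /=; apply: eq_bigr => K /eqP cK.
rewrite (eq_bigr (fun => F K)) => [|c /andP[_ /eqP->]] //.
rewrite sumr_const mulr_natl; congr (_ *+ _).
rewrite -[in RHS]cK -ffactnn {2}cK -[X in _ ^_ X](card_ord k) -(card_inj_ffuns_on 'I_k [in K]).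
apply: eq_card => c; rewrite [RHS]inE andbC.
rewrite -[LHS]/(injectiveb c && ([set c a | a in 'I_k] == K)).
case cI: (injectiveb c) => //=.
apply/eqP/ffun_onP => [<- a|cK']; first exact: imset_f.
apply/eqP; rewrite eqEcard card_imset ?card_ord ?cK ?leqnn ?andbT; last exact/injectiveP.
by apply/fintype.subsetP => _ /imsetP[a _ ->].
Qed.

Lemma sum_set_elt (k : nat) (G : T -> {set T} -> R) :
  \sum_(K : {set T} | #|K| == k) \sum_(w in K) G w K
  = \sum_w \sum_(A : {set T} | (w \notin A) && (#|A|.+1 == k)) G w (w |: A).
Proof.
rewrite (exchange_big_dep predT) //=; apply: eq_bigr => w _.
rewrite (reindex_onto (fun A => w |: A) (fun K => K :\ w)) /=; last first.
  by move=> K /andP[_ wK]; rewrite finset.setD1K.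
apply: eq_bigl => A; rewrite setU11 andbT cardsU1.
case wA: (w \in A) => /=; last by rewrite add1n setU1K ?wA // eqxx andbT.
by apply/negbTE/negP => /andP[_ /eqP /setP/(_ w)]; rewrite !inE eqxx wA.
Qed.

End InjectiveTuples.

Section Maclaurin.
Variables (T : finType) (R : realFieldType) (x : T -> R).
Hypothesis x0 : forall i, 0 <= x i.
Let P (V : {set T}) := \prod_(i in V) x i.
Let e (k : nat) := \sum_(V : {set T} | #|V| == k) P V.
Let n := #|T|.

Let P0 V : 0 <= P V.
Proof. by apply: prodr_ge0. Qed.

Let PU1 w (A : {set T}) : w \notin A -> P (w |: A) = x w * P A.
Proof. by move=> wA; rewrite /P big_setU1. Qed.

Let e_succ k : k.+1%:R * e k.+1
  = \sum_(V : {set T} | #|V| == k) P V * \sum_(u | u \notin V) x u.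
Proof.
transitivity (\sum_(W : {set T} | #|W| == k.+1) \sum_(u in W) P W).
  rewrite /e big_distrr /=; apply: eq_bigr => W /eqP cW.
  by rewrite sumr_const cW mulr_natl.
rewrite (sum_set_elt _ (fun=> P)).
rewrite (exchange_big_dep (fun A : {set T} => #|A| == k)) /=; last first.
  by move=> w A _ /andP[_]; rewrite eqSS.
apply: eq_bigr => A cA; rewrite big_distrr /=.
apply: eq_big => [u|u /andP[uA _]]; first by rewrite eqSS cA andbT.
by rewrite PU1 // mulrC.
Qed.

(** The difference of the two sides is a sum of [P V * (x u - x w)] over [w] in [V] and [u] outside.
    Taking [w] out of [V] and symmetrising in [u] and [w] turns it into minus a sum of squares with
    nonnegative weights. *)
Let e_succ_le k : (k <= n)%N ->
  n%:R * (k.+1%:R * e k.+1) <= (n - k)%:R * (\sum_u x u) * e k.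
Proof.
move=> kn; rewrite e_succ -subr_le0 /e !big_distrr /= -sumrB.
rewrite (eq_bigr (fun V : {set T} => \sum_(w in V)
    (P V * \sum_(u | u \notin V) (x u - x w)))) => [|V /eqP cV]; last first.
  under [in RHS]eq_bigr do rewrite sumrB sumr_const.
  have -> : #|[predC V]| = (n - k)%N by rewrite -cV /n -(cardC V) addKn.
  rewrite -[RHS]big_distrr /= big_split /= sumrN sumr_const cV sumrMnl.
  rewrite -[X in _ - X * _]big_distrr /= [X in _ - _ * X * _](bigID [in V]) /=.
  set U := \sum_(i | i \notin V) x i; set W := \sum_(i in V) x i.
  rewrite -[U *+ k]mulr_natl -[W *+ _]mulr_natl natrB //; ring.
rewrite (sum_set_elt _ (fun w V => P V * \sum_(u | u \notin V) (x u - x w))).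
rewrite (exchange_big_dep (fun A : {set T} => #|A|.+1 == k)) /=; last first.
  by move=> w A _ /andP[].
apply: sumr_le0 => A cA.
rewrite (eq_big (fun w => w \notin A)
    (fun w => P A * \sum_(u | u \notin A) (x u * x w - x w ^+ 2))) /=; first last.
- move=> w /andP[wA _]; rewrite PU1 // [x w * _]mulrC -mulrA; congr (_ * _).
  rewrite big_distrr [RHS](bigD1 w) //= -expr2 subrr add0r.
  apply: eq_big => [u|u _]; first by rewrite !inE negb_or andbC.
  by rewrite mulrBr mulrC expr2.
- by move=> w; rewrite cA andbT.
rewrite -big_distrr /= mulr_ge0_le0 //.
set S := \sum_(_ | _) _; rewrite -(pmulr_rle0 _ (ltr0Sn R 1)) mulr_natl mulr2n.
rewrite {1}/S exchange_big /= -big_split /=; apply: sumr_le0 => u uA.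
rewrite -big_split /=; apply: sumr_le0 => w wA.
have -> : x u * x w - x w ^+ 2 + (x w * x u - x u ^+ 2) = - (x u - x w) ^+ 2 by ring.
by rewrite oppr_le0 sqr_ge0.
Qed.

(* Maclaurin's inequality: the mean of the k-fold products is at most t^k. *)
Lemma sum_inj_prod_le (N : nat) (t : R) k :
  (n <= N)%N -> \sum_u x u = N%:R * t ->
  \sum_(c : {ffun 'I_k -> T} | injectiveb c) \prod_a x (c a)
    <= (N ^_ k)%:R * t ^+ k.
Proof.
move=> nN sx.
have -> : \sum_(c : {ffun 'I_k -> T} | injectiveb c) \prod_a x (c a) = k`!%:R * e k.
  rewrite -sum_inj_image; apply: eq_bigr => c /injectiveP cI.
  by rewrite /P big_imset //= => a b _ _; exact: cI.
elim: k => [|k IH].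
  rewrite ffactn0 expr0 mulr1 mul1r /e (big_pred1 finset.set0) => [|V].
    by rewrite /P big_set0.
  by rewrite cards_eq0.
have e0 : 0 <= e k by apply: sumr_ge0.
case: (ltnP k n) => kn; last first.
  rewrite /e big_pred0 ?mulr0 => [|V].
    have t0 : 0 <= N%:R * t by rewrite -sx sumr_ge0.
    case: (posnP N) => [->|Np]; first by rewrite ffact0n mul0r.
    by rewrite mulr_ge0 ?exprn_ge0 // -(pmulr_rge0 _ (_ : 0 < N%:R)) ?ltr0n.
  by apply/negbTE; rewrite neq_ltn ltnS (leq_trans (max_card _)).
have n0 : (0 : R) < n%:R by rewrite ltr0n (leq_ltn_trans _ kn).
have t0 : 0 <= t.
  rewrite -(pmulr_rge0 _ (_ : 0 < N%:R)) -?sx ?sumr_ge0 //.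
  by apply: lt_le_trans n0 _; rewrite ler_nat.
rewrite -(ler_pM2l n0) factS natrM.
apply: le_trans (_ : k`!%:R * ((n - k)%:R * (N%:R * t) * e k) <= _).
  have -> : n%:R * (k.+1%:R * k`!%:R * e k.+1)
      = k`!%:R * (n%:R * (k.+1%:R * e k.+1)) by ring.
  by rewrite ler_wpM2l // -sx; exact: e_succ_le (ltnW kn).
rewrite ffactnSr natrM exprSr.
have -> : k`!%:R * ((n - k)%:R * (N%:R * t) * e k)
    = (n - k)%:R * N%:R * (t * (k`!%:R * e k)) by ring.
have -> : n%:R * ((N ^_ k)%:R * (N - k)%:R * (t ^+ k * t))
    = n%:R * (N - k)%:R * (t * ((N ^_ k)%:R * t ^+ k)) by ring.
apply: ler_pM => //; try by rewrite ?mulr_ge0.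
  (* [(n - k) N <= n (N - k)]: averaging over [N >= n] variables amounts to adding zero weights.
     This is needed because the ratios are indexed by vertices but normalised by edges. *)
  by rewrite -!natrM ler_nat mulnBl mulnBr leq_sub2l // mulnC leq_mul2l nN orbT.
by rewrite ler_wpM2l.
Qed.
End Maclaurin.

Lemma sum_ffun_tag (R : comNzRingType) (I S T : finType) (b : S -> T)
  (F : {ffun I -> T} -> R) (G : I -> S -> R) :
  \sum_(j : {ffun I -> S}) F [ffun i => b (j i)] * \prod_i G i (j i)
  = \sum_(v : {ffun I -> T}) F v * \prod_i \sum_(f | b f == v i) G i f.
Proof.
rewrite (partition_big (fun j : {ffun I -> S} => [ffun i => b (j i)]) predT) //=.
apply: eq_bigr => v _; rewrite (bigA_distr_big_dep (fun i f => b f == v i)) big_distrr /=.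
apply: eq_big => [j|j /eqP -> //].
apply/eqP/familyP => [<- i|h]; first by rewrite unfold_in /= ffunE.
by apply/ffunP => i; rewrite ffunE; apply/eqP; exact: h.
Qed.

(* [a e] and [b f] are the vertices carrying the head e and the tail f. *)
Section Model.
Variables (R : realFieldType) (n N : nat) (a b : 'I_N -> 'I_n).

Definition odeg u := #|[set e | a e == u]|.
Definition ideg u := #|[set f | b f == u]|.
Definition wt e : R := (odeg (a e))%:R^-1.
Definition incid_mx : 'M[R]_N := \matrix_(f, e) ((b f == a e)%:R * wt e).
Definition cincid_mx : 'M[R]_N := incid_mx - const_mx N%:R^-1.

Hypothesis odeg_gt0 : forall u, (0 < odeg u)%N.
Hypothesis N_gt0 : (0 < N)%N.

Let N0 : N%:R != 0 :> R. Proof. by rewrite pnatr_eq0 -lt0n. Qed.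
Let o0 u : (odeg u)%:R != 0 :> R. Proof. by rewrite pnatr_eq0 -lt0n. Qed.

Lemma sum_odeg : (\sum_u odeg u = N)%N.
Proof.
rewrite -[RHS]card_ord -sum1_card (partition_big a predT) //=.
by apply: eq_bigr => u _; rewrite sum1dep_card.
Qed.

Lemma sum_ideg : (\sum_u ideg u = N)%N.
Proof.
rewrite -[RHS]card_ord -sum1_card (partition_big b predT) //=.
by apply: eq_bigr => u _; rewrite sum1dep_card.
Qed.

Lemma vertices_le : (n <= N)%N.
Proof.
rewrite -[n in X in (X <= _)%N]card_ord -sum1_card -sum_odeg.
by apply: leq_sum => u _.
Qed.

Lemma sum_over_tag (F : 'I_n -> R) u :
  \sum_(e | a e == u) F (a e) = (odeg u)%:R * F u.
Proof.
rewrite (eq_bigr (fun=> F u)) => [|e /eqP-> //].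
by rewrite sumr_const mulr_natl /odeg cardsE.
Qed.

Lemma incid_row f : \sum_e incid_mx f e = 1.
Proof.
under eq_bigr do rewrite mxE.
rewrite (bigID (fun e => a e == b f)) /= [X in _ + X]big1 ?addr0 => [|e]; last first.
  by rewrite eq_sym => /negPf->; rewrite mul0r.
rewrite (eq_bigr (fun e => (odeg (a e))%:R^-1)) => [|e /eqP e_]; last first.
  by rewrite e_ eqxx mul1r /wt e_.
by rewrite (sum_over_tag (fun u => (odeg u)%:R^-1)) divff.
Qed.

Lemma cincid_row f : \sum_e cincid_mx f e = 0.
Proof.
under eq_bigr do rewrite mxE.
rewrite big_split /= incid_row.
under eq_bigr do rewrite !mxE.
by rewrite sumr_const card_ord mulNrn -[_ *+ N]mulr_natr mulVf ?subrr.
Qed.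

Lemma cincid_gram f f' :
  \sum_e cincid_mx f e * cincid_mx f' e
  = (b f == b f')%:R / (odeg (b f))%:R - N%:R^-1.
Proof.
have E e : cincid_mx f e * cincid_mx f' e = incid_mx f e * incid_mx f' e
    - N%:R^-1 * incid_mx f e - N%:R^-1 * incid_mx f' e + N%:R^-1 * N%:R^-1.
  by rewrite [cincid_mx f e]mxE [cincid_mx f' e]mxE !mxE; ring.
under eq_bigr do rewrite E.
rewrite !big_split /= !sumrN -!big_distrr /= !incid_row sumr_const card_ord.
rewrite -[N%:R^-1 *+ N]mulr_natr mulVf // !mulr1 -addrA addNr addr0.
congr (_ - _).
rewrite (bigID (fun e => a e == b f)) /= [X in _ + X]big1 ?addr0 => [|e]; last first.
  by rewrite eq_sym !mxE => /negPf->; rewrite !mul0r.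
rewrite (eq_bigr (fun e => (b f == b f')%:R * (odeg (a e))%:R^-1 * (odeg (a e))%:R^-1))
  => [|e /eqP e_]; last first.
  by rewrite !mxE /wt e_ eqxx mul1r [b f' == _]eq_sym mulrA mulrAC mulrC mulrA.
rewrite (sum_over_tag (fun u => (b f == b f')%:R * (odeg u)%:R^-1 * (odeg u)%:R^-1)).
by rewrite mulrC mulfVK.
Qed.

(* On distinct vertices the Gram matrix is diag(1/d) - J/N, of determinant
   (prod 1/d) (1 - sum d / N); otherwise it has two equal rows. *)
Lemma det_gram_le k (j : 'I_k -> 'I_N) :
  \det (\matrix_(x, y) \sum_e cincid_mx (j x) e * cincid_mx (j y) e)
  <= (injectiveb [ffun x => b (j x)])%:R * \prod_x (odeg (b (j x)))%:R^-1.
Proof.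
set M := \matrix_(x, y) _.
have ME x y : M x y = (b (j x) == b (j y))%:R / (odeg (b (j x)))%:R - N%:R^-1.
  by rewrite mxE cincid_gram.
case bI: (injectiveb _); last first.
  rewrite mul0r; move/injectivePn: bI => [x [y xy]]; rewrite !ffunE => bxy.
  by rewrite (determinant_alternate xy) // => z; rewrite !ME bxy.
rewrite mul1r; pose d : 'rV[R]_k := \row_x (odeg (b (j x)))%:R^-1.
have -> : M = diag_mx d
    *m (1%:M + (\col_x - ((odeg (b (j x)))%:R / N%:R)) *m const_mx 1 : 'M[R]_k).
  apply/matrixP => x y; rewrite ME mul_diag_mx !mxE big_ord1 !mxE mulr1.
  have -> : (b (j x) == b (j y)) = (x == y).
    by have := inj_eq (injectiveP _ bI) x y; rewrite !ffunE.
  by rewrite mulrDr mulrN mulrA mulVf // mul1r mulrC.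
rewrite det_mulmx det_diag det_add1_mulmxC det_mx11 !mxE.
under eq_bigr do rewrite mxE.
rewrite ler_piMr //; first by rewrite prodr_ge0 // => x _; rewrite invr_ge0.
rewrite gerDl; apply: sumr_le0 => x _.
by rewrite !mxE mul1r oppr_le0 divr_ge0.
Qed.

Variable t : R.
Hypothesis sum_ratio : \sum_u (ideg u)%:R / (odeg u)%:R = N%:R * t.

(** Enumerating [K] by injective tuples [c] costs [k!], and [s] maps [c] to a uniform injective
    tuple [j] of rows. Dropping the injectivity of both tuples only adds squares and lets
    Cauchy-Binet sum over the columns, giving the [k!] back. The Gram bound restores distinct
    vertices, as Maclaurin's inequality requires. *)
Lemma sum_pminor_sqr_le (k : nat) :
  \sum_(s : 'S_N) \sum_(K : {set 'I_N} | #|K| == k) pminor (row_perm s cincid_mx) K ^+ 2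
  <= N`!%:R * t ^+ k.
Proof.
have t0 : 0 <= t.
  rewrite -(pmulr_rge0 _ (_ : 0 < N%:R)) ?ltr0n // -sum_ratio.
  by apply: sumr_ge0 => u _; rewrite divr_ge0.
have k0 : (0 : R) < k`!%:R by rewrite ltr0n fact_gt0.
rewrite -(ler_pM2l k0) big_distrr /=.
under eq_bigr do rewrite -sum_inj_image.
rewrite exchange_big /=.
apply: le_trans (_ : (N - k)`!%:R * \sum_(j : {ffun 'I_k -> 'I_N})
  \sum_(c : {ffun 'I_k -> 'I_N}) \det (\matrix_(x, y) cincid_mx (j x) (c y)) ^+ 2 <= _).
  rewrite [X in _ <= _ * X]exchange_big /= big_distrr /= [X in X <= _]big_mkcond /=.
  apply: ler_sum => c _; have S0 (Q : pred {ffun 'I_k -> 'I_N}) :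
    0 <= \sum_(j | Q j) \det (\matrix_(x, y) cincid_mx (j x) (c y)) ^+ 2.
    by apply: sumr_ge0 => j _; exact: sqr_ge0.
  case: ifP => [/injectiveP cI|_]; last by rewrite mulr_ge0.
  pose F (j : {ffun 'I_k -> 'I_N}) := \det (\matrix_(x, y) cincid_mx (j x) (c y)) ^+ 2.
  rewrite (eq_bigr (fun s : 'S_N => F [ffun i => s (c i)])) => [|s _].
    rewrite (sum_perm_restr cI F) card_ord.
    rewrite ler_wpM2l // [X in _ <= X](bigID (fun j : {ffun 'I_k -> 'I_N} => injectiveb j)) /=.
    by rewrite lerDl.
  rewrite pminor_image //; congr (\det _ ^+ 2); apply/matrixP => x y.
  by rewrite !mxE ffunE.
under eq_bigr do rewrite sum_sqr_minor_rows.
rewrite -big_distrr /= mulrCA ler_wpM2l //.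
apply: le_trans (_ : (N - k)`!%:R * ((N ^_ k)%:R * t ^+ k) <= _); last first.
  rewrite mulrA -natrM mulnC; case: (leqP k N) => [kN|kN]; first by rewrite ffact_fact.
  by rewrite ffact_small // mul0n mul0r mulr_ge0 // exprn_ge0.
rewrite ler_wpM2l //.
apply: le_trans (_ : \sum_(v : {ffun 'I_k -> 'I_n} | injectiveb v)
   \prod_x ((ideg (v x))%:R / (odeg (v x))%:R) <= _); last first.
  have r0 u : 0 <= (ideg u)%:R / (odeg u)%:R :> R by rewrite divr_ge0.
  have nN : (#|'I_n| <= N)%N by rewrite card_ord vertices_le.
  exact: (sum_inj_prod_le r0 _ nN sum_ratio).
apply: le_trans (_ : \sum_(j : {ffun 'I_k -> 'I_N})
    (injectiveb [ffun x => b (j x)])%:R * \prod_x (odeg (b (j x)))%:R^-1 <= _).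
  by apply: ler_sum => j _; exact: det_gram_le.
rewrite (sum_ffun_tag b (fun v : {ffun 'I_k -> 'I_n} => (injectiveb v)%:R)
  (fun _ f => (odeg (b f))%:R^-1)).
rewrite [X in _ <= X]big_mkcond /=; apply: ler_sum => v _.
case: (injectiveb v); rewrite ?mul0r // mul1r le_eqVlt; apply/orP; left; apply/eqP.
apply: eq_bigr => x _; rewrite (eq_bigr (fun=> (odeg (v x))%:R^-1)) => [|f /eqP-> //].
by rewrite sumr_const mulr_natl /ideg cardsE.
Qed.

Lemma sum_sqr_coef_le (k : nat) :
  \sum_(s : 'S_N) (\det (1%:M - 'X *: map_mx polyC (row_perm s cincid_mx)))`_k ^+ 2
  <= k.+1%:R * N`!%:R * t ^+ k.
Proof.
under eq_bigr do rewrite coef_det_1BX exprMn sqrr_sign mul1r.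
apply: le_trans (sum_sqr_pminor_le cincid_row k) _.
by rewrite -mulrA ler_wpM2l // sum_pminor_sqr_le.
Qed.
End Model.

(** * Closed walks *)

Section TracePower.
Variables (R : pzRingType) (n : nat) (A : 'M[R]_n).

Let pw := fix pw (x : 'I_n) (t : seq 'I_n) (y : 'I_n) : R :=
  if t is z :: t' then A x z * pw z t' y else A x y.

Let sum_tuple_cons (T : finType) k (F : k.+1.-tuple T -> R) :
  \sum_t F t = \sum_z \sum_(t : k.-tuple T) F (cons_tuple z t).
Proof.
rewrite pair_bigA /= (reindex (fun p : T * k.-tuple T => cons_tuple p.1 p.2)) //=.
exists (fun t : k.+1.-tuple T => (thead t, behead_tuple t)) => [[z t] _|t _] /=.
  by rewrite theadE; congr (_, _); apply: val_inj.
by rewrite [RHS]tuple_eta; apply: val_inj.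
Qed.

Let expr_pw k x y : (A ^+ k.+1) x y = \sum_(t : k.-tuple 'I_n) pw x t y.
Proof.
elim: k x y => [|k IH] x y.
  by rewrite expr1 (big_pred1 [tuple]) // => t; rewrite [t]tuple0; exact/esym/eqP.
rewrite exprS mxE sum_tuple_cons; apply: eq_bigr => z _.
by rewrite IH big_distrr.
Qed.

Let pwE x t y : pw x t y
  = \prod_(i < (size t).+1) A (nth x (x :: t) i) (nth y t i).
Proof.
elim: t x => [|z t IH] x; first by rewrite big_ord1.
rewrite [LHS]/= IH [RHS]big_ord_recl; congr (_ * _).
apply: eq_bigr => i _ /=; congr (A _ _); apply: set_nth_default.
by rewrite /= ltn_ord.
Qed.

Lemma mxtrace_expr k : \tr (A ^+ k.+1)
  = \sum_(e : {ffun 'I_k.+1 -> 'I_n}) \prod_i A (e i) (e (ordS i)).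
Proof.
transitivity (\sum_(t : k.+1.-tuple 'I_n) \prod_i A (tnth t i) (tnth t (ordS i))).
  rewrite sum_tuple_cons; apply: eq_bigr => x _; rewrite expr_pw.
  apply: eq_bigr => t _; rewrite pwE size_tuple; apply: eq_bigr => i _.
  rewrite !(tnth_nth x) /=; congr (A _ _).
  have := ltn_ord i; rewrite ltnS leq_eqVlt => /orP[/eqP ->|ik].
    (* The last edge: [nth] past the end of [t] returns its default, the endpoint, which is the
       starting point of the closed walk. *)
    by rewrite modnn nth_default // size_tuple.
  by rewrite modn_small.
rewrite (reindex (fun e : {ffun 'I_k.+1 -> 'I_n} => [tuple e i | i < k.+1])) /=.
  by apply: eq_bigr => e _; apply: eq_bigr => i _; rewrite !tnth_mktuple.
exists (fun t => [ffun i => tnth t i]) => [e _|t _].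
  by apply/ffunP => i; rewrite ffunE tnth_mktuple.
by apply: eq_from_tnth => i; rewrite tnth_mktuple ffunE.
Qed.
End TracePower.

(** * Probability of walks and their number of vertices *)

Section CountTags.
Variables (R : realFieldType) (I : finType) (n N : nat).
Hypothesis nN : (n <= N)%N.
Hypothesis N_gt0 : (0 < N)%N.

(** Records which values of [v] coincide, by sending each index to a chosen representative of its
    level set. *)
Let rep (v : {ffun I -> 'I_n}) : {ffun I -> I} := [ffun i => odflt i [pick j | v j == v i]].

Let repE (v : {ffun I -> 'I_n}) i : v (rep v i) = v i.
Proof. by rewrite ffunE; case: pickP => [j /eqP|]. Qed.

Let rep_eq (v : {ffun I -> 'I_n}) i j : (rep v i == rep v j) = (v i == v j).
Proof.
apply/eqP/eqP => [h|h]; first by rewrite -repE h repE.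
rewrite !ffunE; under eq_pick do rewrite h.
by case: pickP => //= /(_ j); rewrite eqxx.
Qed.

Let card_rep (v : {ffun I -> 'I_n}) : #|v @: I| = #|rep v @: I|.
Proof.
have -> : v @: I = v @: (rep v @: I).
  by rewrite -imset_comp; apply: eq_imset => i /=; rewrite repE.
apply: card_in_imset => _ _ /imsetP[i _ ->] /imsetP[j _ ->].
by rewrite !repE => /eqP; rewrite -rep_eq => /eqP.
Qed.

(** There are at most [#|I| ^ #|I|] coincidence patterns. A pattern with [d] classes is shared by at
    most [n ^ d <= N ^ d] functions, so it contributes at most 1. *)
Lemma sum_card_image_le :
  \sum_(v : {ffun I -> 'I_n}) N%:R ^- #|v @: I| <= (#|I| ^ #|I|)%:R :> R.
Proof.
have N0 : (0 : R) < N%:R by rewrite ltr0n.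
rewrite (partition_big rep predT) //= -(card_ffun I I) -sum1_card natr_sum.
apply: ler_sum => c _.
rewrite (eq_bigr (fun=> N%:R ^- #|c @: I|)) => [|v /eqP <-]; last by rewrite card_rep.
rewrite sumr_const -[X in X <= _]mulr_natl ler_pdivrMr ?exprn_gt0 // mul1r -natrX ler_nat.
apply: leq_trans (_ : n ^ #|c @: I| <= _)%N; last by case: #|_| => // d; rewrite leq_exp2r.
pose J := {i | i \in c @: I}.
have -> : (n ^ #|c @: I| = #|{ffun J -> 'I_n}|)%N by rewrite card_ffun card_ord card_sig.
pose f (v : {ffun I -> 'I_n}) : {ffun J -> 'I_n} := [ffun x => v (val x)].
rewrite -cardsE -(card_in_imset (f := f)) ?max_card // => u v.
rewrite !finset.in_set => ru rv /ffunP fuv; apply/ffunP => i.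
have {}ru : rep u = c by apply/eqP.
have {}rv : rep v = c by apply/eqP.
have ci : c i \in c @: I by rewrite imset_f.
have := fuv (exist (fun i => i \in c @: I) _ ci); rewrite !ffunE /=.
by rewrite -{1}ru -{1}rv !repE.
Qed.
End CountTags.

Section Average.
Variables (R : realFieldType) (N : nat).
Implicit Types X Y : 'S_N -> R.

Definition avg X : R := N`!%:R^-1 * \sum_s X s.

Lemma avg_le X Y : (forall s, X s <= Y s) -> avg X <= avg Y.
Proof.
by move=> XY; rewrite ler_wpM2l ?invr_ge0 //; apply: ler_sum => s _.
Qed.

Lemma eq_avg X Y : X =1 Y -> avg X = avg Y.
Proof. by move=> XY; congr (_ * _); apply: eq_bigr => s _. Qed.

Lemma avgD X Y : avg (fun s => X s + Y s) = avg X + avg Y.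
Proof. by rewrite /avg big_split mulrDr. Qed.

Lemma avgZ c X : avg (fun s => c * X s) = c * avg X.
Proof. by rewrite /avg -big_distrr mulrCA. Qed.

Lemma avg_sum (I : finType) (P : pred I) (F : I -> 'S_N -> R) :
  avg (fun s => \sum_(i | P i) F i s) = \sum_(i | P i) avg (F i).
Proof. by rewrite /avg exchange_big big_distrr. Qed.

Lemma avg_cst c : avg (fun=> c) = c.
Proof.
have f0 : N`!%:R != 0 :> R by rewrite pnatr_eq0 -lt0n fact_gt0.
by rewrite /avg sumr_const cardT -cardE card_Sn -[c *+ _]mulr_natl mulKf.
Qed.

Lemma avg_restr (I : finType) (e : I -> 'I_N) (F : {ffun I -> 'I_N} -> R) :
  injective e ->
  avg (fun s => F [ffun i => s (e i)])
  = (\sum_(f : {ffun I -> 'I_N} | injectiveb f) F f) / (N ^_ #|I|)%:R.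
Proof.
move=> eI; rewrite /avg (sum_perm_restr eI F).
have IN : (#|I| <= N)%N by rewrite -[N in X in (_ <= X)%N]card_ord (leq_card e eI).
have f0 : (N - #|I|)`!%:R != 0 :> R by rewrite pnatr_eq0 -lt0n fact_gt0.
by rewrite -(ffact_fact IN) natrM invfM mulrA mulfVK 1?mulrC.
Qed.
End Average.

Lemma natr_forall (R : comNzRingType) (I : finType) (P : pred I) :
  [forall i, P i]%:R = \prod_i (P i)%:R :> R.
Proof.
case: forallP => [h|/forallP]; first by rewrite big1 // => i _; rewrite h.
by rewrite negb_forall => /existsP[i /negPf Pi]; rewrite (bigD1 i) //= Pi mul0r.
Qed.

Section WalkProbability.
Variables (R : realFieldType) (n N : nat) (a b : 'I_N -> 'I_n).
Local Notation di := (ideg b).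
Local Notation od := (odeg a).

Section Event.
Variables (I : finType) (e : I -> 'I_N) (v : I -> 'I_n).
Hypothesis eI : injective e.

Let cnt_tag u : \sum_(f : 'I_N) (b f == u)%:R = (di u)%:R :> R.
Proof.
rewrite -natr_sum /ideg -sum1dep_card [in RHS]big_mkcond.
by congr (_%:R); apply: eq_bigr => f _; case: eqP.
Qed.

Let sum_event : \sum_(f : {ffun I -> 'I_N}) [forall i, b (f i) == v i]%:R
  = \prod_i (di (v i))%:R :> R.
Proof.
rewrite (eq_bigr (fun f : {ffun I -> 'I_N} => \prod_i (b (f i) == v i)%:R))
  => [|f _]; last first.
  exact: (natr_forall R (fun i => b (f i) == v i)).
rewrite -(bigA_distr_bigA (fun i f => (b f == v i)%:R)).
by apply: eq_bigr => i _; rewrite cnt_tag.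
Qed.

Let avg_event : avg (fun s : 'S_N => [forall i, b (s (e i)) == v i]%:R)
  = (\sum_(f : {ffun I -> 'I_N} | injectiveb f) [forall i, b (f i) == v i]%:R)
     / (N ^_ #|I|)%:R :> R.
Proof.
rewrite -(avg_restr (fun f => [forall i, b (f i) == v i]%:R) eI).
apply: eq_avg => s; congr ((nat_of_bool _)%:R).
by apply: eq_forallb => i; rewrite ffunE.
Qed.

Lemma avg_event_le : avg (fun s : 'S_N => [forall i, b (s (e i)) == v i]%:R)
  <= (\prod_i (di (v i))%:R) / (N ^_ #|I|)%:R :> R.
Proof.
rewrite avg_event ler_wpM2r ?invr_ge0 // -sum_event.
rewrite [X in _ <= X](bigID (fun f : {ffun I -> 'I_N} => injectiveb f)) /=.
by rewrite lerDl sumr_ge0.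
Qed.

(** Distinct prescribed vertices force distinct tails, so the restriction to injective tuples,
    dropped for the upper bound, loses nothing here. *)
Lemma avg_event_inj : injective v ->
  avg (fun s : 'S_N => [forall i, b (s (e i)) == v i]%:R)
  = (\prod_i (di (v i))%:R) / (N ^_ #|I|)%:R :> R.
Proof.
move=> vI; rewrite avg_event -sum_event; congr (_ / _).
rewrite [RHS](bigID (fun f : {ffun I -> 'I_N} => injectiveb f)) /=.
rewrite [X in _ + X]big1 ?addr0 // => f /injectivePn[i [j ij fij]].
case: forallP => // h; case/eqP: ij; apply: vI.
by rewrite -(eqP (h i)) -(eqP (h j)) fij.
Qed.
End Event.

(* [nx] is the successor of the time step: [ordS] for one closed walk, and
   [next2] below for a pair of closed walks. *)
Definition walk (I : finType) (nx : I -> I) (e : {ffun I -> 'I_N}) (s : 'S_N) :=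
  [forall i, b (s (e i)) == a (e (nx i))].
Definition simple (I : finType) (e : {ffun I -> 'I_N}) := injectiveb [ffun i => a (e i)].
(* A tangled walk leaves some vertex through two different heads, so it has fewer
   vertices than edges; this costs a factor 1/N. *)
Definition tangled (I : finType) (e : {ffun I -> 'I_N}) :=
  [exists i, exists j, (a (e i) == a (e j)) && (e i != e j)].

Lemma simple_inj (I : finType) (e : {ffun I -> 'I_N}) : simple e -> injective e.
Proof.
by move=> /injectiveP h i j eij; apply: h; rewrite !ffunE eij.
Qed.

Lemma simple_tag_inj (I : finType) (e : {ffun I -> 'I_N}) :
  simple e -> injective (fun i => a (e i)).
Proof. by move=> /injectiveP h i j eij; apply: h; rewrite !ffunE eij. Qed.

Variable D : nat.
Hypothesis odeg_gt0 : forall u, (0 < od u)%N.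
Hypothesis odeg_le : forall u, (od u <= D)%N.
Hypothesis ideg_le : forall u, (di u <= D)%N.
Hypothesis N_gt0 : (0 < N)%N.

Let n_le_N : (n <= N)%N. Proof. exact: vertices_le odeg_gt0. Qed.

Lemma sum_card_tags_le (I : finType) :
  \sum_(e : {ffun I -> 'I_N}) N%:R ^- #|[ffun i => a (e i)] @: I|
  <= (D ^ #|I| * #|I| ^ #|I|)%:R :> R.
Proof.
rewrite (eq_bigr (fun e : {ffun I -> 'I_N} => N%:R ^- #|[ffun i => a (e i)] @: I|
   * \prod_(i : I) 1)) => [|e _]; last by rewrite big1_eq mulr1.
rewrite (sum_ffun_tag a (fun v : {ffun I -> 'I_n} => N%:R ^- #|v @: I|) (fun _ _ => 1)).
rewrite natrM mulrC [(D ^ _)%:R]natrX; apply: le_trans (_ : (\sum_(v : {ffun I -> 'I_n})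
   N%:R ^- #|v @: I|) * D%:R ^+ #|I| <= _); last first.
  by rewrite ler_wpM2r ?exprn_ge0 ?ler0n // sum_card_image_le.
rewrite big_distrl /=; apply: ler_sum => v _; rewrite ler_wpM2l ?invr_ge0 ?exprn_ge0 //.
rewrite -[X in _ <= X]prodr_const; apply: ler_prod => i _.
rewrite sumr_const -cardsE; apply/andP; split => //.
by rewrite ler_nat odeg_le.
Qed.

(** The walk imposes one condition on each of the [r] distinct heads it uses, hence a probability of
    order [N ^- r]; being tangled, it visits fewer than [r] vertices, which frees one factor [1/N].
    [pre] selects a time at which a given head is used. *)
Lemma avg_tangled_le (I : finType) (nx : I -> I) (e : {ffun I -> 'I_N}) :
  (#|I|.*2 <= N)%N -> tangled e ->
  avg (fun s => (walk nx e s)%:R)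
  <= (D.*2 ^ #|I|)%:R * N%:R^-1 * N%:R ^- #|[ffun i => a (e i)] @: I| :> R.
Proof.
move=> IN te; pose J : finType := {x | x \in e @: I}.
have J_ex (x : J) : [exists i, e i == val x].
  by have /imsetP[i _ ->] := valP x; apply/existsP; exists i.
pose pre (x : J) := xchoose (existsP (J_ex x)).
have preE x : e (pre x) = val x by apply/eqP; exact: (xchooseP (existsP (J_ex x))).
pose r := #|e @: I|; have cJ : #|J| = r by rewrite card_sig.
have rI : (r <= #|I|)%N by exact: leq_imset_card.
have rN : (r.*2 <= N)%N by apply: leq_trans IN; rewrite leq_double.
apply: le_trans (_ : (\prod_(x : J) (di (a (e (nx (pre x)))))%:R) / (N ^_ #|J|)%:R <= _).
  apply: le_trans (@avg_event_le J (fun x => val x) (fun x => a (e (nx (pre x)))) val_inj).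
  apply: avg_le => s; rewrite ler_nat.
  case w: (walk nx e s) => //; rewrite lt0b; apply/forallP => x.
  by rewrite -preE; exact: (forallP w).
have tags : (#|[ffun i => a (e i)] @: I| < r)%N.
  have -> : [ffun i => a (e i)] @: I = a @: (e @: I).
    by rewrite -imset_comp; apply: eq_imset => i; rewrite ffunE.
  rewrite ltn_neqAle leq_imset_card andbT; apply/negP => /imset_injP aI.
  case/existsP: te => i /existsP[j /andP[/eqP aij]]; case/negP.
  by apply/eqP; apply: aI aij; exact: imset_f.
have N0 : (0 : R) < N%:R by rewrite ltr0n.
have N1 : (1 : R) <= N%:R by rewrite ler1n.
(* All factors of [N ^_ r] are at least [N / 2], since [r <= N / 2]; this is the origin of
   [D.*2]. *)
have ffact_ge : (N%:R / 2) ^+ r <= (N ^_ r)%:R :> R.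
  rewrite ffact_prod natr_prod -[X in _ ^+ X](card_ord r) -prodr_const.
  apply: ler_prod => i _; rewrite divr_ge0 //=.
  rewrite ler_pdivrMr // -natrM ler_nat.
  by have := ltn_ord i; move: rN; rewrite -muln2; lia.
have D_gt0 : (0 < D)%N.
  case/existsP: te => i _; exact: leq_trans (odeg_gt0 (a (e i))) (odeg_le _).
rewrite cJ; apply: le_trans (_ : D%:R ^+ r / (N%:R / 2) ^+ r <= _).
  apply: ler_pM.
  - by apply: prodr_ge0.
  - by rewrite invr_ge0.
  - rewrite -cJ -prodr_const; apply: ler_prod => x _.
    by rewrite ler0n ler_nat ideg_le.
  - by rewrite lef_pV2 ?posrE // ?exprn_gt0 ?divr_gt0 // ltr0n ffact_gt0;
      move: rN; rewrite -addnn; lia.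
have -> : D%:R ^+ r / (N%:R / 2) ^+ r = D.*2%:R ^+ r / N%:R ^+ r :> R.
  rewrite -!expr_div_n -mul2n natrM; congr (_ ^+ _).
  by field; rewrite pnatr_eq0 -lt0n.
rewrite -mulrA; apply: ler_pM.
- exact: exprn_ge0.
- by rewrite invr_ge0 exprn_ge0.
- by rewrite natrX ler_weXn2l // ler1n double_gt0.
- by rewrite -invfM -exprS lef_pV2 ?posrE ?exprn_gt0 // ler_weXn2l.
Qed.

(** The first factor comes from the probability of a given walk, the second from the weighted count
    of walks in [sum_card_tags_le]. *)
Definition tangle_cst (m : nat) := (D.*2 ^ m * (D ^ m * m ^ m))%N.

Lemma avg_sum_tangled_le (I : finType) (nx : I -> I) :
  (#|I|.*2 <= N)%N ->
  avg (fun s => \sum_(e : {ffun I -> 'I_N} | tangled e) (walk nx e s)%:R)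
  <= (tangle_cst #|I|)%:R / N%:R :> R.
Proof.
move=> IN; rewrite avg_sum.
apply: le_trans (_ : \sum_(e : {ffun I -> 'I_N} | tangled e)
  (D.*2 ^ #|I|)%:R * N%:R^-1 * N%:R ^- #|[ffun i => a (e i)] @: I| <= _).
  by apply: ler_sum => e te; exact: avg_tangled_le.
rewrite -big_distrr /= /tangle_cst natrM mulrAC -mulrA -[X in _ <= X]mulrA.
rewrite ler_wpM2l // mulrC [X in _ <= X]mulrC ler_wpM2l ?invr_ge0 //.
apply: le_trans (sum_card_tags_le I).
rewrite [X in _ <= X](bigID (fun e : {ffun I -> 'I_N} => tangled e)) /=.
by rewrite lerDl sumr_ge0 // => e _; rewrite invr_ge0 exprn_ge0.
Qed.
End WalkProbability.

Lemma ffact_le_expn N m : (N ^_ m <= N ^ m)%N.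
Proof.
by elim: m => // m IH; rewrite ffactnSr expnSr leq_mul // leq_subr.
Qed.

Lemma ffact_ge_expn (R : realFieldType) N m : (0 < N)%N -> (m <= N)%N ->
  (1 - (m * m)%:R / N%:R) * N%:R ^+ m <= (N ^_ m)%:R :> R.
Proof.
move=> N0; elim: m => [|m IH] mN; first by rewrite mul0n mul0r subr0 mul1r.
have {}IH := IH (ltnW mN); rewrite ffactnSr [(N ^_ m * _)%:R]natrM natrB ?(ltnW mN) //.
have mN' : (0 : R) <= N%:R - m%:R by rewrite subr_ge0 ler_nat ltnW.
apply: le_trans (ler_wpM2r mN' IH).
rewrite exprS !natrM -natr1; set z : R := N%:R; set y : R := m%:R.
set x : R := z ^+ m.
have z0 : z != 0 by rewrite pnatr_eq0 -lt0n.
have -> : (1 - (y + 1) * (y + 1) / z) * (z * x) = (z - (y + 1) * (y + 1)) * x by field.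
rewrite mulrAC ler_wpM2r ?exprn_ge0 // -subr_ge0.
have -> : (1 - y * y / z) * (z - y) - (z - (y + 1) * (y + 1)) = y * y * y / z + y + 1.
  by field.
by rewrite !addr_ge0 // divr_ge0 // !mulr_ge0.
Qed.

(** [1/(1 - q) <= 1 + 2 q] for [q <= 1/2], applied to [q = m^2 / N]. *)
Lemma expn_ffact_le (R : realFieldType) N m : (0 < N)%N -> ((m * m).*2 <= N)%N ->
  N%:R ^+ m / (N ^_ m)%:R <= 1 + (m * m).*2%:R / N%:R :> R.
Proof.
move=> N0 mN.
have mN' : (m <= N)%N.
  by apply: leq_trans mN; case: m => // m; rewrite -addnn mulSn -addnA leq_addr.
rewrite ler_pdivrMr ?ltr0n ?ffact_gt0 //.
set q : R := (m * m)%:R / N%:R.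
have -> : (m * m).*2%:R / N%:R = 2 * q :> R by rewrite -mul2n natrM mulrA.
have q0 : 0 <= q by rewrite divr_ge0.
have q2 : 2 * q <= 1.
  by rewrite mulrA -natrM mul2n ler_pdivrMr ?ltr0n // mul1r ler_nat.
have h0 : 0 <= 1 + 2 * q by lra.
apply: le_trans (_ : _ <= _) (ler_wpM2l h0 (ffact_ge_expn R N0 mN')).
rewrite mulrA -[X in X <= _]mul1r ler_wpM2r ?exprn_ge0 // -/q.
by nra.
Qed.

Section SimpleWalks.
Variables (R : realFieldType) (n N : nat) (a b : 'I_N -> 'I_n).
Local Notation di := (ideg b).
Local Notation od := (odeg a).
Local Notation w := (wt R a).

Definition simple_sum (I : finType) (nx : I -> I) (g : 'I_N -> R) (s : 'S_N) : R :=
  \sum_(e : {ffun I -> 'I_N} | simple a e) (walk a b nx e s)%:R * \prod_i g (e i).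

Lemma avg_simple_sum_le (I : finType) (nx : I -> I) (g : 'I_N -> R) : injective nx ->
  (forall x, 0 <= g x) ->
  avg (simple_sum nx g)
  <= (\sum_x g x * (di (a x))%:R) ^+ #|I| / (N ^_ #|I|)%:R.
Proof.
move=> nxI g0; rewrite /simple_sum avg_sum -[X in X ^+ _]/(_ _) .
rewrite -prodr_const (bigA_distr_bigA (fun (_ : I) x => g x * (di (a x))%:R)) /=.
rewrite big_distrl /= [X in X <= _]big_mkcond /=; apply: ler_sum => e _.
rewrite big_split /=.
have P0 : 0 <= \prod_i g (e i) by apply: prodr_ge0.
have D0 : 0 <= \prod_i (di (a (e i)))%:R :> R by apply: prodr_ge0.
case: ifP => se; last by rewrite mulr_ge0 ?invr_ge0 // mulr_ge0.
under eq_avg do rewrite mulrC.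
(* As [nx] permutes the time steps, the in-degree of each successor can be regrouped with the weight
   of that successor, and the sum over [e] factorises. *)
rewrite avgZ -mulrA ler_wpM2l // [X in _ <= X / _](reindex_inj nxI).
exact: (avg_event_le R b (fun i => a (e (nx i))) (simple_inj se)).
Qed.

Variable D : nat.
Hypothesis odeg_gt0 : forall u, (0 < od u)%N.
Hypothesis odeg_le : forall u, (od u <= D)%N.
Hypothesis ideg_le : forall u, (di u <= D)%N.
Hypothesis N_gt0 : (0 < N)%N.

Lemma wt_ge0 x : 0 <= w x. Proof. by rewrite invr_ge0. Qed.
Lemma wt_le1 x : w x <= 1.
Proof. by rewrite invf_le1 ?ltr0n ?ler1n. Qed.

(** The source of the 1 subtracted from the traces: the weighted number of simple closed walks has
    mean close to [N^k / N^k]. *)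
Lemma sum_wt_ideg : \sum_x w x * (di (a x))%:R = N%:R.
Proof.
rewrite (partition_big a predT) //= -[in RHS](sum_ideg b) natr_sum.
apply: eq_bigr => u _.
rewrite (sum_over_tag a (fun u => (od u)%:R^-1 * (di u)%:R)) mulVKf //.
by rewrite pnatr_eq0 -lt0n.
Qed.

(** For simple tuples the probabilities are exact, and the weights of all tuples add up to [N^k]. A
    tuple that is not simple meets fewer than [k] vertices, so inserting the factor
    [N^-1 N^k N^-(number of vertices) >= 1] shows that these tuples weigh only [O(N^(k-1))] in
    total. *)
Lemma avg_simple_sum_ge (I : finType) (nx : I -> I) : injective nx -> (#|I| <= N)%N ->
  1 - (D ^ #|I| * (D ^ #|I| * #|I| ^ #|I|))%:R / N%:R <= avg (simple_sum nx w).
Proof.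
move=> nxI IN; set k := #|I|.
have N0 : (0 : R) < N%:R by rewrite ltr0n.
pose y x : R := w x * (di (a x))%:R.
have y0 x : 0 <= y x by rewrite mulr_ge0 ?wt_ge0.
have yD x : y x <= D%:R.
  rewrite -[X in _ <= X]mul1r; apply: ler_pM; rewrite ?wt_ge0 ?wt_le1 //.
  by rewrite ler_nat.
have -> : avg (simple_sum nx w)
    = (\sum_(e : {ffun I -> 'I_N} | simple a e) \prod_i y (e i)) / (N ^_ k)%:R.
  rewrite /simple_sum avg_sum big_distrl /=; apply: eq_bigr => e se.
  under eq_avg do rewrite mulrC.
  rewrite avgZ (avg_event_inj R b (simple_inj se) (v := fun i => a (e (nx i)))).
    by rewrite mulrA big_split /=; congr (_ * _ / _); rewrite [RHS](reindex_inj nxI).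
  by move=> i j /(simple_tag_inj se)/nxI.
set S := \sum_(e | _) _.
have S0 : 0 <= S by apply: sumr_ge0 => e _; apply: prodr_ge0.
apply: le_trans (_ : S / N%:R ^+ k <= _); last first.
  rewrite ler_wpM2l // lef_pV2 ?posrE ?exprn_gt0 ?ltr0n ?ffact_gt0 //.
  by rewrite -natrX ler_nat ffact_le_expn.
rewrite ler_pdivlMr ?exprn_gt0 // mulrBl mul1r lerBlDr.
have E : N%:R ^+ k = \sum_(e : {ffun I -> 'I_N}) \prod_i y (e i).
  by rewrite -(bigA_distr_bigA (fun _ x => y x)) /= prodr_const sum_wt_ideg.
rewrite {1}E (bigID (fun e => simple a e)) /= lerD2l natrM -!mulrA.
apply: le_trans (_ : \sum_(e : {ffun I -> 'I_N} | ~~ simple a e)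
   D%:R ^+ k * (N%:R^-1 * N%:R ^+ k * N%:R ^- #|[ffun i => a (e i)] @: I|) <= _).
  apply: ler_sum => e se.
  apply: le_trans (_ : D%:R ^+ k <= _).
    rewrite /k -prodr_const; apply: ler_prod => i _.
    by rewrite y0 yD.
  rewrite ler_peMr ?exprn_ge0 //.
  have lt_tags : (#|[ffun i => a (e i)] @: I| < k)%N.
    rewrite ltn_neqAle leq_imset_card andbT; apply: contra se => /imset_injP h.
    by apply/injectiveP => i j; apply: h.
  rewrite mulrAC -invfM -exprS mulrC ler_pdivlMr ?exprn_gt0 // mul1r.
  by rewrite ler_weXn2l // ler1n.
rewrite -!big_distrr /= natrX -mulrA ler_wpM2l ?exprn_ge0 //.
rewrite [X in _ <= X]mulrC mulrA.
rewrite ler_wpM2l ?mulr_ge0 ?invr_ge0 ?exprn_ge0 //.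
apply: le_trans (sum_card_tags_le R odeg_gt0 odeg_le N_gt0 I).
rewrite [X in _ <= X](bigID (fun e : {ffun I -> 'I_N} => simple a e)) /=.
by rewrite lerDr sumr_ge0 // => e _; rewrite invr_ge0 exprn_ge0.
Qed.
End SimpleWalks.

Section CyclicOrdinals.
Variable k : nat.

Lemma val_iter_ordS c (i : 'I_k.+1) : val (iter c (@ordS _) i) = ((i + c) %% k.+1)%N.
Proof.
elim: c => [|c IH]; first by rewrite addn0 modn_small.
by rewrite iterS /= IH -addn1 modnDml addn1 addnS.
Qed.

Lemma iter_ordS_reach (x y : 'I_k.+1) : exists c : 'I_k.+1, iter c (@ordS _) y = x.
Proof.
exists (inord ((x + (k.+1 - y)) %% k.+1)); apply: val_inj.
rewrite val_iter_ordS inordK ?ltn_mod // modnDmr addnCA subnKC; last exact: ltnW.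
by rewrite modnDr modn_small.
Qed.

Lemma iter_ordS_inj c : injective (iter c (@ordS k.+1)).
Proof.
by elim: c => // c IH i j /= /ordS_inj /IH.
Qed.
End CyclicOrdinals.

Lemma tangledPn n N (a : 'I_N -> 'I_n) (I : finType) (e : {ffun I -> 'I_N}) :
  ~~ tangled a e -> forall i j, a (e i) = a (e j) -> e i = e j.
Proof.
move=> te i j aij; apply/eqP; apply: contraNT te => eij.
by apply/existsP; exists i; apply/existsP; exists j; rewrite aij eqxx eij.
Qed.

Section PairsOfWalks.
Variables (R : realFieldType) (n N : nat) (a b : 'I_N -> 'I_n) (k : nat).
Local Notation w := (wt R a).
Local Notation K := 'I_k.+1.
Local Notation S := (@ordS k.+1).

Definition next2 (i : K + K) : K + K :=
  match i with inl x => inl (S x) | inr x => inr (S x) end.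

Lemma next2_inj : injective next2.
Proof.
by move=> [x|x] [y|y] // h; congr (_ _); apply: (@ordS_inj k.+1);
  apply: val_inj; case: h.
Qed.

Let lh (e : {ffun K + K -> 'I_N}) : {ffun K -> 'I_N} := [ffun x => e (inl x)].
Let rh (e : {ffun K + K -> 'I_N}) : {ffun K -> 'I_N} := [ffun x => e (inr x)].

Let sum_halves (F : {ffun K -> 'I_N} -> {ffun K -> 'I_N} -> R) :
  \sum_e \sum_e' F e e' = \sum_e F (lh e) (rh e).
Proof.
rewrite pair_bigA /= (reindex (fun e => (lh e, rh e))) //=.
exists (fun p : {ffun K -> 'I_N} * {ffun K -> 'I_N} =>
  [ffun i : K + K => match i with inl x => p.1 x | inr x => p.2 x end]).
  by move=> e _; apply/ffunP => -[x|x]; rewrite !ffunE.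
by move=> [e e'] _; congr (_, _); apply/ffunP => x; rewrite !ffunE.
Qed.

Let simple_sumE (I : finType) (nx : I -> I) g s : simple_sum a b nx g s
  = \sum_(e : {ffun I -> 'I_N}) (simple a e && walk a b nx e s)%:R * \prod_i g (e i) :> R.
Proof.
rewrite /simple_sum big_mkcond; apply: eq_bigr => e _.
by case: (simple a e); rewrite //= mul0r.
Qed.

Let shift c (e : {ffun K -> 'I_N}) : {ffun K -> 'I_N} := [ffun i => e (iter c S i)].

Let walk_halves e s : walk a b next2 e s = walk a b S (lh e) s && walk a b S (rh e) s.
Proof.
apply/forallP/andP => [h|[/forallP h1 /forallP h2] [x|x] /=].
- by split; apply/forallP => x; rewrite !ffunE; [exact: (h (inl x))|exact: (h (inr x))].
- by have := h1 x; rewrite !ffunE.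
- by have := h2 x; rewrite !ffunE.
Qed.

Let prod_halves (g : 'I_N -> R) (e : {ffun K + K -> 'I_N}) :
  \prod_i g (e i) = (\prod_x g (lh e x)) * \prod_x g (rh e x).
Proof.
by rewrite big_sumType /=; congr (_ * _); apply: eq_bigr => x _; rewrite ffunE.
Qed.

(* Outside tangled pairs the next head is a function of the current one, hence
   two closed walks sharing a head are rotations of each other. *)
Let rotation (e : {ffun K + K -> 'I_N}) s x y : ~~ tangled a e ->
  walk a b S (lh e) s -> walk a b S (rh e) s -> lh e x = rh e y ->
  exists c : K, rh e = shift c (lh e).
Proof.
move=> te /forallP wl /forallP wr exy.
have [c cE] := iter_ordS_reach x y; exists c; apply/ffunP => i; rewrite [RHS]ffunE.
have [d <-] := iter_ordS_reach i y; elim: (val d) => [|m IH] /=; first by rewrite cE.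
rewrite -iterSr iterS ![in LHS]ffunE ![in RHS]ffunE.
apply: (tangledPn te).
have := wr (iter m S y); have := wl (iter c S (iter m S y)).
by rewrite IH !ffunE => /eqP <- /eqP <-.
Qed.

(** A pair of simple closed walks is vertex-disjoint, or tangled (where the weights are bounded by
    1), or consists of a walk and one of its [k + 1] rotations, which squares the weights. *)
Lemma sqr_simple_sum_le (s : 'S_N) : (forall x, w x <= 1) ->
  simple_sum a b S w s ^+ 2
  <= simple_sum a b next2 w s + \sum_(c : K) simple_sum a b S (fun x => w x ^+ 2) s
     + \sum_(e : {ffun K + K -> 'I_N} | tangled a e) (walk a b next2 e s)%:R.
Proof.
move=> w1; have w0 x : 0 <= w x by rewrite invr_ge0.
pose G e := (simple a e && walk a b S e s)%:R * \prod_i w (e i) ^+ 2.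
have G0 e : 0 <= G e by rewrite mulr_ge0 // prodr_ge0 // => i _; rewrite sqr_ge0.
have -> : \sum_(c : K) simple_sum a b S (fun x => w x ^+ 2) s
   = \sum_(e : {ffun K + K -> 'I_N}) \sum_(c : K) (rh e == shift c (lh e))%:R * G (lh e).
  rewrite -(sum_halves (fun e e' => \sum_(c : K) (e' == shift c e)%:R * G e)).
  under [RHS]eq_bigr do rewrite exchange_big /=.
  rewrite [RHS]exchange_big /=; apply: eq_bigr => c _; rewrite simple_sumE.
  apply: eq_bigr => e _; rewrite (bigD1 (shift c e)) //= eqxx mul1r.
  by rewrite [X in _ + X]big1 ?addr0 // => e' /negPf->; rewrite mul0r.
rewrite expr2 2!simple_sumE big_distrlr /= sum_halves [X in _ <= _ + X]big_mkcond /=.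
rewrite -!big_split /=; apply: ler_sum => e _.
set Sc := \sum_(c : K) _.
have Sc0 : 0 <= Sc by apply: sumr_ge0 => c _; rewrite mulr_ge0.
have T0 : 0 <= (if tangled a e then (walk a b next2 e s)%:R else 0 : R) by case: ifP.
have P0 : 0 <= \prod_i w (e i) by apply: prodr_ge0.
have F0 : 0 <= (simple a e && walk a b next2 e s)%:R * \prod_i w (e i) by rewrite mulr_ge0.
rewrite mulrACA -prod_halves -natrM mulnb.
case: ifP => [te|/negbT te].
  apply: le_trans (_ : (walk a b next2 e s)%:R <= _); last by rewrite lerDr addr_ge0.
  rewrite walk_halves; case: (walk _ _ _ (lh e) _); rewrite ?andbF ?mul0r //.
  case: (walk _ _ _ (rh e) _); rewrite ?andbF ?mul0r // !andbT.
  apply: le_trans (_ : \prod_i w (e i) <= _).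
    by rewrite ler_piMl //; case: (_ && _).
  by apply: prodr_ile1 => i; rewrite w0 w1.
rewrite addr0; case: andP => [[/andP[sl wl] /andP[sr wr]]|_]; last by rewrite mul0r addr_ge0.
rewrite mul1r walk_halves wl wr andbT.
case se: (simple a e); first by rewrite mul1r lerDl.
(* In an untangled pair a repeated vertex is a repeated head; both walks being simple, it must be
   shared by the two. *)
rewrite mul0r add0r; move/injectivePn: se => [i [j ij]]; rewrite !ffunE => /(tangledPn te) eij.
have [x [y exy]] : exists x y, lh e x = rh e y.
  case: i j ij eij => [x|x] [y|y] ij eij.
  - case/eqP: ij; congr inl; apply: (simple_inj sl); by rewrite !ffunE.
  - by exists x, y; rewrite !ffunE.
  - by exists y, x; rewrite !ffunE.
  - case/eqP: ij; congr inr; apply: (simple_inj sr); by rewrite !ffunE.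
have [c rE] := rotation te wl wr exy.
rewrite /Sc (bigD1 c) //= rE eqxx mul1r {1}/G sl wl mul1r.
have -> : \prod_i w (e i) = \prod_i w (lh e i) ^+ 2.
  rewrite prod_halves rE prodrXl expr2; congr (_ * _).
  rewrite [RHS](reindex_inj (@iter_ordS_inj k c)) /=.
  by apply: eq_bigr => i0 _; rewrite ffunE.
by rewrite lerDl sumr_ge0 // => d _; rewrite mulr_ge0.
Qed.
End PairsOfWalks.

Lemma prod_mod_period (R : comNzRingType) l m (F : 'I_l.+1 -> R) :
  \prod_(i < m * l.+1) F (inord (i %% l.+1)) = \prod_j F j ^+ m.
Proof.
rewrite -(big_mkord predT (fun i => F (inord (i %% l.+1)))) big_nat_mul.
under eq_bigr => i _.
  rewrite -{1}[(i * l.+1)%N]add0n big_addn mulSn addnK.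
  under eq_bigr => j _ do rewrite addnC modnMDl.
  rewrite big_mkord; under eq_bigr => j _ do rewrite modn_small // inord_val.
over.
by rewrite prodr_const_nat subn0 prodrXl.
Qed.

Section NonSimpleWalks.
Variables (R : realFieldType) (n N : nat) (a b : 'I_N -> 'I_n).
Local Notation w := (wt R a).

Section Periodic.
Variables (k : nat) (s : 'S_N) (e : {ffun 'I_k.+1 -> 'I_N}).
Hypothesis we : walk a b (@ordS _) e s.
Hypothesis te : ~~ tangled a e.
Hypothesis se : ~~ simple a e.

(** Periodic extension of [e] to all times, which makes rotations and return times plain
    arithmetic. *)
Let E (i : nat) : 'I_N := e (inord (i %% k.+1)).

Let E_ord (i : 'I_k.+1) : E i = e i.
Proof. by rewrite /E modn_small // inord_val. Qed.

Let E_step i : b (s (E i)) = a (E i.+1).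
Proof.
rewrite (eqP (forallP we _)); congr (a (e _)); apply: val_inj => /=.
by rewrite !inordK ?ltn_mod // -addn1 modnDml addn1.
Qed.

Let E_shift (t i j : nat) : E i = E j -> E (i + t)%N = E (j + t)%N.
Proof.
elim: t => [|t IH] eij; first by rewrite !addn0.
by rewrite !addnS; apply: (tangledPn te); rewrite -!E_step IH.
Qed.

Let return_ex : exists p, (0 < p)%N && (E p == E 0%N).
Proof. by exists k.+1; rewrite /E modnn mod0n eqxx. Qed.

Let l := ex_minn return_ex.

Let E_return (i j : nat) : (i < j)%N -> E i = E j -> E (j - i)%N = E 0%N.
Proof.
(* [m] carries time [i] to a multiple of the period, where the walk is at its initial head. *)
move=> ij eij; have [m kE] : exists m, (i + m)%N = (i.+1 * k.+1)%N.
  by exists (i.+1 * k.+1 - i)%N; rewrite subnKC // (leq_trans (leqnSn i)) // leq_pmulr.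
have Em q : E (q * k.+1)%N = E 0%N by rewrite /E modnMl mod0n.
have := E_shift m eij; rewrite kE Em => ->.
have -> : (j + m)%N = ((j - i) + i.+1 * k.+1)%N by rewrite -kE; lia.
by rewrite /E addnC modnMDl.
Qed.

Let l_gt0 : (0 < l)%N.
Proof. by rewrite /l; case: ex_minnP => p /andP[]. Qed.

Let E_l : E l = E 0%N.
Proof. by rewrite /l; case: ex_minnP => p /andP[_ /eqP]. Qed.

Let l_min p : (0 < p)%N -> E p = E 0%N -> (l <= p)%N.
Proof.
by move=> p0 Ep; rewrite /l; case: ex_minnP => m _; apply; rewrite p0 Ep eqxx.
Qed.

Let l_lt : (l < k.+1)%N.
Proof.
have H (i j : 'I_k.+1) : (i < j)%N -> e i = e j -> (l < k.+1)%N.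
  move=> ij eij; apply: leq_ltn_trans (_ : j - i < k.+1)%N.
    by apply: l_min; [rewrite subn_gt0|apply: E_return; rewrite ?E_ord].
  exact: leq_ltn_trans (leq_subr _ _) (ltn_ord j).
move/injectivePn: se => [i [j ij]]; rewrite !ffunE => /(tangledPn te) eij.
case: (ltngtP i j) => [ltij|ltji|/val_inj eqij]; first exact: H ltij eij.
  exact: H ltji (esym eij).
by rewrite eqij eqxx in ij.
Qed.

Let E_mod i : E i = E (i %% l)%N.
Proof.
rewrite {1}(divn_eq i l); elim: (i %/ l)%N => [|q IH]; first by rewrite mul0n.
rewrite mulSn -addnA -[RHS]IH -[in RHS](add0n (_ + _)%N).
exact: E_shift E_l.
Qed.

Let l_dvd : (l %| k.+1)%N.
Proof.
have : E (k.+1 %% l)%N = E 0%N by rewrite -E_mod /E modnn mod0n.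
rewrite /dvdn; case: (posnP (k.+1 %% l)) => [->//|m0 Em].
by have := l_min m0 Em; rewrite leqNgt ltn_mod l_gt0.
Qed.

(* [l] is the first return time to the initial head. *)
Lemma periodic_walk : exists (m : 'I_k) (e' : {ffun 'I_m.+1 -> 'I_N}),
  [/\ (m.+1 %| k.+1)%N, simple a e', walk a b (@ordS _) e' s &
    forall i, e i = e' (inord (i %% m.+1))].
Proof.
have ml : (l.-1.+1 = l)%N by rewrite prednK.
have mk : (l.-1 < k)%N by rewrite -ltnS ml l_lt.
exists (Ordinal mk); exists [ffun j : 'I_(l.-1.+1) => E j]; split => /=.
- by rewrite ml l_dvd.
- apply/injectiveP => i j; rewrite !ffunE => /(tangledPn te).
  have H (x y : 'I_(l.-1.+1)) : (x < y)%N -> E x = E y -> False.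
    move=> xy exy; have := l_min _ (E_return xy exy); rewrite subn_gt0 => /(_ xy).
    rewrite leqNgt => /negP; apply; apply: leq_ltn_trans (leq_subr _ _) _.
    by rewrite -[X in (_ < X)%N]ml.
  case: (ltngtP i j) => [ij|ji|/val_inj ->] // eij; first by case: (H _ _ ij eij).
  by case: (H _ _ ji (esym eij)).
- apply/forallP => j; rewrite !ffunE E_step; apply/eqP; congr (a _).
  by rewrite [LHS]E_mod -[X in E (_ %% X)%N = _]ml.
- move=> i; rewrite ffunE inordK ?ltn_mod // ml -E_mod.
  by rewrite E_ord.
Qed.
End Periodic.

(** An untangled closed walk that is not simple runs several times round a simple one, whose length
    [m + 1] is a proper divisor of [k + 1]; each head then contributes a power of its weight. *)
Lemma nonsimple_sum_le k (s : 'S_N) : (forall x, w x <= 1) ->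
  \sum_(e : {ffun 'I_k.+1 -> 'I_N} | ~~ simple a e)
     (walk a b (@ordS _) e s)%:R * \prod_i w (e i)
  <= \sum_(e : {ffun 'I_k.+1 -> 'I_N} | tangled a e) (walk a b (@ordS _) e s)%:R
   + \sum_(m < k | (m.+1 %| k.+1)%N)
       simple_sum a b (@ordS m.+1) (fun x => w x ^+ (k.+1 %/ m.+1)) s.
Proof.
move=> w1; have w0 x : 0 <= w x by rewrite invr_ge0.
pose H (m : 'I_k) (e' : {ffun 'I_m.+1 -> 'I_N}) : R :=
  (walk a b (@ordS _) e' s)%:R * \prod_i w (e' i) ^+ (k.+1 %/ m.+1).
have H0 m e' : 0 <= @H m e'.
  by rewrite mulr_ge0 // prodr_ge0 // => i _; rewrite exprn_ge0.
pose ext (m : 'I_k) (e' : {ffun 'I_m.+1 -> 'I_N}) : {ffun 'I_k.+1 -> 'I_N} :=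
  [ffun i : 'I_k.+1 => e' (inord (i %% m.+1))].
have -> : \sum_(m < k | (m.+1 %| k.+1)%N)
       simple_sum a b (@ordS m.+1) (fun x => w x ^+ (k.+1 %/ m.+1)) s
  = \sum_(e : {ffun 'I_k.+1 -> 'I_N}) \sum_(m < k | (m.+1 %| k.+1)%N)
     \sum_(e' : {ffun 'I_m.+1 -> 'I_N} | simple a e') (e == ext m e')%:R * H m e'.
  rewrite exchange_big /=; apply: eq_bigr => m _.
  rewrite exchange_big /=; apply: eq_bigr => e' _.
  rewrite (bigD1 (ext m e')) //= eqxx mul1r [X in _ + X]big1 ?addr0 // => e /negPf->.
  by rewrite mul0r.
rewrite [X in X <= _]big_mkcond [X in _ <= X + _]big_mkcond -big_split /=.
apply: ler_sum => e _; set T := \sum_(m < k | _) _.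
have T0 : 0 <= T by apply: sumr_ge0 => m _; apply: sumr_ge0 => e' _; rewrite mulr_ge0.
have P1 : \prod_i w (e i) <= 1 by apply: prodr_ile1 => i; rewrite w0 w1.
have A0 : 0 <= (if tangled a e then (walk a b (@ordS _) e s)%:R else 0 : R) by case: ifP.
case: ifP => se; last by rewrite addr_ge0.
case we: (walk _ _ _ _ _); last by rewrite mul0r; case: ifP; rewrite add0r.
rewrite mul1r; case: ifP => [_|/negbT te].
  by apply: le_trans P1 _; rewrite lerDl.
have [m [e' [mk se' we' eE]]] := periodic_walk we te se.
rewrite add0r /T (bigD1 m) //= (bigD1 e') //=.
have -> : e = ext m e' by apply/ffunP => i; rewrite ffunE eE.
rewrite eqxx mul1r {1}/H we' mul1r.
have -> : \prod_i w (ext m e' i) = \prod_i w (e' i) ^+ (k.+1 %/ m.+1).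
  rewrite -prod_mod_period divnK //; apply: eq_bigr => i _.
  by rewrite ffunE.
rewrite -addrA lerDl addr_ge0 //.
  by apply: sumr_ge0 => e'' _; rewrite mulr_ge0.
by apply: sumr_ge0 => m' _; apply: sumr_ge0 => e'' _; rewrite mulr_ge0.
Qed.
End NonSimpleWalks.

(** * Mean deviation of the traces from 1 *)

Section TraceDeviation.
Variables (R : realFieldType) (n N : nat) (a b : 'I_N -> 'I_n).
Local Notation di := (ideg b).
Local Notation od := (odeg a).
Local Notation w := (wt R a).

Lemma mxtrace_walks k (s : 'S_N) :
  \tr (row_perm s (incid_mx R a b) ^+ k.+1)
  = \sum_(e : {ffun 'I_k.+1 -> 'I_N}) (walk a b (@ordS _) e s)%:R * \prod_i w (e i).
Proof.
rewrite mxtrace_expr; apply: eq_bigr => e _.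
rewrite (natr_forall R (fun i => b (s (e i)) == a (e (ordS i)))).
rewrite [X in _ = _ * X](reindex_inj (@ordS_inj k.+1)) -big_split /=.
by apply: eq_bigr => i _; rewrite !mxE.
Qed.

Variable D : nat.
Hypothesis odeg_gt0 : forall u, (0 < od u)%N.
Hypothesis odeg_le : forall u, (od u <= D)%N.
Hypothesis ideg_le : forall u, (di u <= D)%N.
Hypothesis N_gt0 : (0 < N)%N.
Variables t r : R.
Hypothesis sum_ratio : \sum_u (di u)%:R / (od u)%:R = N%:R * t.
Hypothesis r_gt0 : 0 < r.
Hypothesis t_le : t <= r ^+ 2.
Hypothesis wt_le : forall x, w x <= r.

Let w1 := wt_le1 R odeg_gt0.
Let w0 := wt_ge0 R a.
Let N0 : (0 : R) < N%:R. Proof. by rewrite ltr0n. Qed.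

Let sum_wt_sqr : \sum_x w x ^+ 2 * (di (a x))%:R = N%:R * t.
Proof.
rewrite -sum_ratio (partition_big a predT) //=; apply: eq_bigr => u _.
rewrite (sum_over_tag a (fun u => (od u)%:R^-1 ^+ 2 * (di u)%:R)).
by rewrite expr2 !mulrA mulfV ?mul1r 1?mulrC // pnatr_eq0 -lt0n.
Qed.

(** Two of the [q] weights yield [t <= r^2], and the remaining [q - 2] are at most [r]. This is why
    [r] must dominate the weights, and not only the square root of [t]. *)
Let sum_wt_pow q : (1 < q)%N -> \sum_x w x ^+ q * (di (a x))%:R <= N%:R * r ^+ q.
Proof.
move=> q1; rewrite -(subnKC q1) exprD mulrA.
apply: le_trans (_ : N%:R * t * r ^+ (q - 2) <= _); last first.
  by rewrite ler_wpM2r ?exprn_ge0 ?(ltW r_gt0) // ler_wpM2l // ltW.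
rewrite -sum_wt_sqr big_distrl /=; apply: ler_sum => x _.
rewrite exprD mulrAC ler_wpM2l ?mulr_ge0 ?sqr_ge0 //.
by rewrite lerXn2r ?nnegrE ?w0 ?(ltW r_gt0).
Qed.

Section FixedLength.
Variable k : nat.
Local Notation K := k.+1.
Hypothesis N_ge : ((K.*2 * K.*2).*2 <= N)%N.

Let ratio_le2 m : (m <= K)%N -> N%:R ^+ m / (N ^_ m)%:R <= 2 :> R.
Proof.
move=> mK; have mN : ((m * m).*2 <= N)%N.
  apply: leq_trans N_ge; rewrite leq_double; apply: leq_mul;
  by apply: leq_trans mK _; rewrite -addnn leq_addr.
apply: le_trans (expn_ffact_le R N_gt0 mN) _.
by rewrite -[X in _ <= X](natrD R 1 1) natrD lerD2l ler_pdivrMr // mul1r ler_nat.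
Qed.

Let periodic_le (m : 'I_k) : (m.+1 %| K)%N ->
  avg (simple_sum a b (@ordS m.+1) (fun x => w x ^+ (K %/ m.+1))) <= 2 * r ^+ K.
Proof.
move=> mK; have q1 : (1 < K %/ m.+1)%N.
  by rewrite ltn_divRL // mul1n ltnS.
apply: le_trans (avg_simple_sum_le a b (@ordS_inj _) _) _.
  by move=> x; rewrite exprn_ge0.
rewrite card_ord; apply: le_trans (_ : (N%:R * r ^+ (K %/ m.+1)) ^+ m.+1 / (N ^_ m.+1)%:R <= _).
  rewrite ler_wpM2r ?invr_ge0 // lerXn2r ?nnegrE ?sum_wt_pow //.
    by apply: sumr_ge0 => x _; rewrite mulr_ge0 ?exprn_ge0.
  by rewrite mulr_ge0 ?exprn_ge0 ?(ltW r_gt0).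
rewrite exprMn -exprM divnK // mulrAC ler_wpM2r ?exprn_ge0 ?(ltW r_gt0) //.
by apply: ratio_le2; rewrite ltnS ltnW.
Qed.

(** The four terms come from: the falling factorial for a pair of walks, tangled pairs, twice the
    defect of the mean of simple walks (from expanding the square of [X - 1]), and single tangled
    walks. *)
Definition trace_cst (D K : nat) :=
  ((K.*2 * K.*2).*2 + tangle_cst D K.*2 + 2 * (D ^ K * (D ^ K * K ^ K))
   + tangle_cst D K)%N.

Let X := simple_sum a b (@ordS K) w.

Let card2 : #|{: 'I_K + 'I_K}| = K.*2.
Proof. by rewrite card_sum card_ord addnn. Qed.

Let avg_sqrX : avg (fun s => X s ^+ 2)
  <= 1 + (K.*2 * K.*2).*2%:R / N%:R + K%:R * (2 * r ^+ K.*2)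
     + (tangle_cst D K.*2)%:R / N%:R.
Proof.
apply: le_trans (avg_le (fun s => sqr_simple_sum_le b k s w1)) _.
rewrite avgD avgD lerD //.
  rewrite lerD //.
    apply: le_trans (avg_simple_sum_le a b (@next2_inj k) w0) _.
    by rewrite card2 (sum_wt_ideg R b odeg_gt0) // expn_ffact_le.
  rewrite avg_sum sumr_const card_ord mulr_natl ler_wMn2r //.
  apply: le_trans (avg_simple_sum_le a b (@ordS_inj _) _) _.
    by move=> x; rewrite sqr_ge0.
  rewrite card_ord sum_wt_sqr; apply: le_trans (_ : (N%:R * r ^+ 2) ^+ K / (N ^_ K)%:R <= _).
    rewrite ler_wpM2r ?invr_ge0 // lerXn2r ?nnegrE //.
    - by rewrite -sum_wt_sqr; apply: sumr_ge0 => x _; rewrite mulr_ge0 ?sqr_ge0.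
    - by rewrite mulr_ge0 ?sqr_ge0.
    - by rewrite ler_wpM2l // ltW.
  rewrite exprMn -exprM mul2n mulrAC ler_wpM2r ?exprn_ge0 ?(ltW r_gt0) //.
  exact: ratio_le2.
have := avg_sum_tangled_le R odeg_gt0 odeg_le ideg_le N_gt0 (@next2 k).
rewrite card2; apply; apply: leq_trans N_ge.
by rewrite leq_double leq_pmulr // double_gt0.
Qed.

(** Simple walks are treated by their second moment about 1, of order [2 K r^(2K)] up to [O(1/N)];
    the others by their mean, where each of at most [k] divisors costs [2 r^K]. *)
Lemma avg_trace_deviation :
  avg (fun s => `|\tr (row_perm s (incid_mx R a b) ^+ K) - 1|)
  <= (3 * K + 1)%:R * r ^+ K + (trace_cst D K)%:R * (1 + r ^- K) / N%:R.
Proof.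
have KN : (K <= N)%N.
  by apply: leq_trans N_ge; rewrite -!addnn; nia.
set c := (K.*2 * K.*2).*2; set T2 := tangle_cst D K.*2.
set c1 := (D ^ K * (D ^ K * K ^ K))%N; set T1 := tangle_cst D K.
have rK : 0 < r ^+ K by rewrite exprn_gt0.
have X1 : 1 - c1%:R / N%:R <= avg X.
  have := avg_simple_sum_ge R odeg_gt0 odeg_le ideg_le N_gt0 (@ordS_inj K).
  by rewrite card_ord; apply.
have V : avg (fun s => (X s - 1) ^+ 2)
   <= K%:R * (2 * r ^+ K.*2) + (c%:R + T2%:R + 2 * c1%:R) / N%:R.
  rewrite (eq_avg (Y := fun s => X s ^+ 2 + ((-2) * X s + 1))); last first.
    by move=> s; ring.
  rewrite avgD avgD avgZ avg_cst.
  move: avg_sqrX X1; rewrite -/c -/T2.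
  have -> : (c%:R + T2%:R + 2 * c1%:R) / N%:R
    = c%:R / N%:R + T2%:R / N%:R + 2 * (c1%:R / N%:R) :> R by ring.
  by set y := K%:R * _; lra.
pose W s := \sum_(e : {ffun 'I_K -> 'I_N} | ~~ simple a e)
     (walk a b (@ordS _) e s)%:R * \prod_i w (e i).
have W0 s : 0 <= W s.
  by apply: sumr_ge0 => e _; rewrite mulr_ge0 // prodr_ge0.
have WA : avg W <= T1%:R / N%:R + k%:R * (2 * r ^+ K).
  apply: le_trans (avg_le (fun s => nonsimple_sum_le b k s w1)) _.
  rewrite avgD lerD //.
    have := avg_sum_tangled_le R odeg_gt0 odeg_le ideg_le N_gt0 (@ordS K).
    by rewrite card_ord; apply; apply: leq_trans N_ge; rewrite -!addnn; nia.
  rewrite avg_sum; apply: le_trans (_ : \sum_(m < k) 2 * r ^+ K <= _); last first.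
    by rewrite sumr_const card_ord [X in _ <= X]mulr_natl.
  rewrite big_mkcond; apply: ler_sum => m _; case: ifP => [/periodic_le //|_].
  by rewrite mulr_ge0 ?ltW.
(* [|u| <= (u^2 / r^K + r^K) / 2] stands in for Cauchy-Schwarz. It divides the [1/N] errors of the
   second moment by [r^K], whence the factor [1 + r ^- K]. *)
apply: le_trans (_ : avg (fun s => (2^-1 * r ^- K) * (X s - 1) ^+ 2
    + (2^-1 * r ^+ K + W s)) <= _).
  apply: avg_le => s; rewrite mxtrace_walks (bigID (fun e => simple a e)) /=.
  rewrite -/(simple_sum a b (@ordS K) w s) -/(X s) -/(W s) addrAC addrA.
  apply: le_trans (ler_normD _ _) _; rewrite (ger0_norm (W0 s)) lerD2r.
  set u := X s - 1; rewrite -real_normK ?num_real //.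
  rewrite -subr_ge0.
  have -> : 2^-1 * r ^- K * `|u| ^+ 2 + 2^-1 * r ^+ K - `|u|
     = 2^-1 * r ^- K * (`|u| - r ^+ K) ^+ 2 by field; rewrite gt_eqF.
  by rewrite mulr_ge0 ?sqr_ge0 // mulr_ge0 ?invr_ge0 // ltW.
rewrite avgD avgD avgZ avg_cst.
have h0 : 0 <= 2^-1 * r ^- K by rewrite mulr_ge0 ?invr_ge0 // ltW.
apply: le_trans (lerD (ler_wpM2l h0 V) (lerD (lexx _) WA)) _.
have e2 : r ^+ K.*2 = r ^+ K * r ^+ K by rewrite -addnn exprD.
have -> : (trace_cst D K)%:R = c%:R + T2%:R + 2 * c1%:R + T1%:R :> R.
  by rewrite /trace_cst -/c -/T2 -/c1 -/T1 3!natrD; congr (_ + _ + _); rewrite natrM.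
rewrite e2 natrD natrM.
have k1 : K%:R = k%:R + 1 :> R by rewrite natr1.
set x := r ^+ K; set v := N%:R^-1.
have v0 : 0 <= v by rewrite invr_ge0 ltW.
have x0 : x != 0 by rewrite gt_eqF.
set S := c%:R + T2%:R + _.
have S0 : 0 <= S by apply: addr_ge0; [exact: addr_ge0|exact: mulr_ge0].
set T := T1%:R; have T0 : 0 <= T by rewrite /T.
have p0 : 0 <= x^-1 * v by rewrite mulr_ge0 // invr_ge0 ltW.
have -> : 2^-1 * x^-1 * (K%:R * (2 * (x * x)) + S * v)
     + (2^-1 * x + (T * v + k%:R * (2 * x)))
   = (K%:R + 2 * k%:R + 2^-1) * x + 2^-1 * (S * (x^-1 * v)) + T * v by field.
have -> : (3 * K%:R + 1) * x + (S + T) * (1 + x^-1) * v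
   = (3 * K%:R + 1) * x + (S * v + T * v + S * (x^-1 * v) + T * (x^-1 * v)) by ring.
have Sv : 0 <= S * v by rewrite mulr_ge0.
have Tp : 0 <= T * (x^-1 * v) by rewrite mulr_ge0.
have Sp : 0 <= S * (x^-1 * v) by rewrite mulr_ge0.
rewrite -addrA lerD //; last by lra.
by rewrite ler_wpM2r ?ltW // k1; lra.
Qed.
End FixedLength.
End TraceDeviation.

(** * Roots from coefficients and power sums *)

Section PowerSums.
Variable C : numFieldType.
Implicit Types (L : seq C) (x : C).

Definition rev_poly L : {poly C} := \prod_(x <- L) (1 - x *: 'X).
Definition psum L k := \sum_(x <- L) x ^+ k.

(** [h] is the sequence of complete homogeneous symmetric functions of [L], that is, the
    coefficients of the inverse of [rev_poly L]; the last clause is Newton's identity. *)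
Lemma complete_symmetric_ex L : exists h : nat -> C,
  [/\ h 0%N = 1,
      forall k, \sum_(i < k.+1) (rev_poly L)`_i * h (k - i)%N = (k == 0%N)%:R &
      forall k, k%:R * h k = \sum_(j < k) psum L j.+1 * h (k - j.+1)%N].
Proof.
elim: L => [|x L [h [h0 hC hN]]].
  exists (fun k => (k == 0%N)%:R); split => // k.
    rewrite big_ord_recl big1 => [|i _].
      by rewrite /rev_poly big_nil coefC eqxx mul1r subn0 addr0.
    by rewrite /rev_poly big_nil coefC /= mul0r.
  case: k => [|k]; first by rewrite mul0r big_ord0.
  by rewrite mulr0 big1 // => i _; rewrite /psum big_nil mul0r.
(* Division of the generating series by [1 - x 'X]. Below, [s] and [u] are the parts of Newton's sum
   due to [L] and to the new [x]. *)
pose h' := fix h' k := if k is k'.+1 then h k + x * h' k' else h 0%N.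
have fE0 : (rev_poly (x :: L))`_0 = (rev_poly L)`_0.
  by rewrite /rev_poly big_cons mulrBl mul1r coefB -scalerAl coefZ coefXM mulr0 subr0.
have fES i : (rev_poly (x :: L))`_i.+1 = (rev_poly L)`_i.+1 - x * (rev_poly L)`_i.
  by rewrite /rev_poly big_cons mulrBl mul1r coefB -scalerAl coefZ coefXM.
exists h'; split => //.
  move=> k; rewrite -hC; case: k => [|k].
    by rewrite !big_ord_recl !big_ord0 fE0.
  rewrite big_ord_recl fE0 subn0.
  under eq_bigr => i _ do rewrite lift0 fES mulrBl subSS.
  rewrite big_split /= sumrN addrA.
  have -> : (rev_poly L)`_0 * (h k.+1 + x * h' k)
      + \sum_(i < k.+1) (rev_poly L)`_i.+1 * h' (k - i)%N
    = \sum_(i < k.+2) (rev_poly L)`_i * h' (k.+1 - i)%N.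
    by rewrite [RHS]big_ord_recl subn0; congr (_ + _); apply: eq_bigr.
  rewrite [in X in X - _]big_ord_recr /= [RHS]big_ord_recr /= subnn addrAC -sumrB.
  congr (_ + _); apply: eq_bigr => i _.
  have ik : (i <= k)%N by case: i.
  by rewrite (subSn ik) /= mulrDr -[x * _ * _]mulrA [x * (_ * _)]mulrCA addrK.
pose s k := \sum_(j < k) psum L j.+1 * h' (k - j.+1)%N.
pose u k := \sum_(j < k) x ^+ j.+1 * h' (k - j.+1)%N.
have sS k : s k.+1 = k.+1%:R * h k.+1 + x * s k.
  rewrite hN /s big_ord_recr [X in _ = X + _]big_ord_recr /= subnn [in RHS]addrAC.
  congr (_ + _); rewrite big_distrr -big_split /=; apply: eq_bigr => j _.
  by rewrite subSS -[(k - j)%N]prednK ?subn_gt0 //= -subnS mulrDr mulrCA.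
have uS k : u k.+1 = x * h' k + x * u k.
  rewrite /u big_ord_recl subSS subn0 expr1 big_distrr; congr (_ + _).
  by apply: eq_bigr => j _; rewrite lift0 subSS exprS /= mulrA.
have E k : k%:R * h' k = s k + u k.
  elim: k => [|k IH]; first by rewrite mul0r /s /u !big_ord0 addr0.
  rewrite sS uS [h' _]/= mulrDr -addrA; congr (_ + _).
  by rewrite addrCA -mulrDr -IH -natr1; ring.
move=> k; rewrite E /s /u -big_split /=; apply: eq_bigr => j _.
by rewrite /psum big_cons mulrDl addrC.
Qed.

(** [A] bounds the coefficients of [f] at scale [beta], and [(K + 1) B^B] those of its truncated
    inverse. The growth in [K] is only linear, so for [beta < gamma] the conclusion fails once [K]
    is large. *)
Lemma root_lt L (beta gamma A : C) (B K : nat) x :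
  0 < beta -> 0 < gamma -> beta <= gamma -> (0 < B)%N ->
  \sum_(i < size (rev_poly L)) `|(rev_poly L)`_i| / beta ^+ i <= A ->
  \sum_(k < K) `|psum L k.+1| / beta ^+ k.+1 <= B%:R ->
  x \in L -> gamma <= `|x| ->
  1 <= A * (K.+1 * B ^ B)%:R * (beta / gamma) ^+ K.+1.
Proof.
move=> b0 g0 bg B0 HA HB xL gx.
have [h [h0 hC hN]] := complete_symmetric_ex L.
set f := rev_poly L in HA hC.
pose al i := `|h i| / beta ^+ i.
have bX0 i : 0 < beta ^+ i by rewrite exprn_gt0.
have al0 i : 0 <= al i by rewrite divr_ge0 // ltW.
have B1 : 1 <= B%:R :> C by rewrite ler1n.
(* Newton's identity gives [al (m + 1) <= B / (m + 1)] times the previous maximum. The factor is at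
   most [B] in the first [B] steps and at most 1 afterwards, so the bound stops growing at [B^B]. *)
have alB m : (m <= K)%N -> forall i, (i <= m)%N -> al i <= B%:R ^+ minn m B.
  elim: m => [|m IH] mK i.
    by rewrite leqn0 => /eqP ->; rewrite min0n /al h0 normr1 expr0 divr1.
  rewrite leq_eqVlt => /orP[/eqP -> {i}|im]; last first.
    apply: le_trans (IH (ltnW mK) i im) _; rewrite ler_weXn2l //.
    by rewrite leq_min geq_minr (leq_trans (geq_minl _ _)).
  have m0 : (0 : C) < m.+1%:R by rewrite ltr0n.
  have S : m.+1%:R * al m.+1 <= B%:R * B%:R ^+ minn m B.
    rewrite /al mulrA -[m.+1%:R]ger0_norm // -normrM hN.
    apply: le_trans (_ : \sum_(j < m.+1) `|psum L j.+1| / beta ^+ j.+1 * al (m - j)%N <= _).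
      rewrite ler_pdivrMr // (le_trans (ler_norm_sum _ _ _)) // big_distrl /=.
      apply: ler_sum => j _; rewrite normrM subSS /al.
      have -> : beta ^+ m.+1 = beta ^+ j.+1 * beta ^+ (m - j).
        by rewrite -exprD; congr (_ ^+ _); have := ltn_ord j; lia.
      by rewrite mulrACA !divfK ?gt_eqF.
    apply: le_trans (_ : \sum_(j < m.+1) `|psum L j.+1| / beta ^+ j.+1 * B%:R ^+ minn m B <= _).
      apply: ler_sum => j _; rewrite ler_wpM2l ?divr_ge0 ?(ltW (bX0 _)) //.
      by apply: IH; rewrite ?(ltnW mK) ?leq_subr.
    rewrite -big_distrl /= ler_wpM2r ?exprn_ge0 //; apply: le_trans HB.
    rewrite -(big_mkord predT (fun j => `|psum L j.+1| / beta ^+ j.+1)).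
    rewrite -(big_mkord predT (fun j => `|psum L j.+1| / beta ^+ j.+1)).
    rewrite (big_cat_nat (n := m.+1) (p := K)) //= lerDl sumr_ge0 // => j _.
    by rewrite divr_ge0 // ltW.
  rewrite -(ler_pM2l m0); apply: le_trans S _.
  case: (ltnP m B) => mB.
    rewrite (minn_idPl mB) -exprS ler_peMl ?exprn_ge0 //.
    by rewrite ler1n.
  rewrite (minn_idPr (leqW mB)) ler_wpM2r ?exprn_ge0 //.
  by rewrite ler_nat leqW.
have alK j : (j <= K)%N -> al j <= B%:R ^+ B.
  move=> jK; apply: le_trans (alB K (leqnn _) j jK) _.
  by rewrite ler_weXn2l // geq_minr.
have x0 : x != 0 by rewrite -normr_gt0 (lt_le_trans g0).
(* [U] and [V] are majorants, at scale [beta], of [f] and of the truncated inverse [H]. Their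
   product majorises [f * H], and its value at 1 is the sum of its coefficients. *)
pose H := \poly_(j < K.+1) h j.
pose U := \poly_(i < size f) (`|f`_i| / beta ^+ i).
pose V := \poly_(j < K.+1) al j.
have UE i : U`_i = `|f`_i| / beta ^+ i.
  rewrite coef_poly; case: ltnP => // fi.
  by rewrite (nth_default _ fi) normr0 mul0r.
have VE j : V`_j = `|H`_j| / beta ^+ j.
  by rewrite !coef_poly; case: ltnP => // _; rewrite normr0 mul0r.
have fHlow m : (m <= K)%N -> (f * H)`_m = (m == 0%N)%:R.
  move=> mK; rewrite coefM -hC; apply: eq_bigr => i _.
  by rewrite coef_poly ltnS (leq_trans (leq_subr _ _) mK).
have fH m : `|(f * H)`_m| / beta ^+ m <= (U * V)`_m.
  rewrite !coefM ler_pdivrMr // (le_trans (ler_norm_sum _ _ _)) // big_distrl /=.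
  apply: ler_sum => i _; rewrite normrM UE VE.
  have -> : beta ^+ m = beta ^+ i * beta ^+ (m - i).
    by rewrite -exprD subnKC // -ltnS.
  by rewrite mulrACA !divfK ?gt_eqF.
have UV0 m : 0 <= (U * V)`_m.
  by apply: le_trans (fH m); rewrite divr_ge0 // ltW.
have fx : (f * H).[x^-1] = 0.
  rewrite hornerM /f /rev_poly (big_rem x xL) /= !hornerE.
  by rewrite mulfV // subrr !mul0r.
pose d := (size (f * H)%R + size (U * V)%R)%N.
have : (f * H).[x^-1] = \sum_(m < d) (f * H)`_m * x^-1 ^+ m.
  by apply: horner_coef_wide; exact: leq_addr.
have UVsum : \sum_(m < d) (U * V)`_m <= A * (K.+1 * B ^ B)%:R.
  have -> : \sum_(m < d) (U * V)`_m = (U * V).[1].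
    rewrite (@horner_coef_wide _ d) ?leq_addl //.
    by apply: eq_bigr => m _; rewrite expr1n mulr1.
  rewrite hornerM; apply: ler_pM.
  - rewrite horner_poly; apply: sumr_ge0 => i _.
    by rewrite expr1n mulr1 divr_ge0 // ltW.
  - by rewrite horner_poly; apply: sumr_ge0 => i _; rewrite expr1n mulr1.
  - by rewrite horner_poly; under eq_bigr do rewrite expr1n mulr1.
  - rewrite horner_poly; apply: le_trans (_ : \sum_(j < K.+1) B%:R ^+ B <= _).
      by apply: ler_sum => j _; rewrite expr1n mulr1 alK // -ltnS.
    by rewrite sumr_const card_ord natrM natrX mulr_natl.
have d_gt0 : (0 < d)%N.
  rewrite /d addn_gt0 size_poly_gt0; apply/orP; left; apply/eqP => fH0.
  by have := fHlow 0%N (leq0n _); rewrite fH0 coef0 => /eqP; rewrite eq_sym oner_eq0.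
rewrite fx; case: d d_gt0 UVsum => // d _ UVsum.
(* At [x^-1] the product vanishes while its constant term is 1, so the remaining terms have sum -1;
   those of degree 1 to [K] are zero. *)
rewrite big_ord_recl fHlow // mul1r expr0 => /eqP.
rewrite eq_sym addr_eq0 => /eqP S1.
have E1 : (1 : C) = `|\sum_(i < d) (f * H)`_(lift ord0 i) * x^-1 ^+ lift ord0 i|.
  by rewrite -normrN -S1 normr1.
rewrite [X in X <= _]E1; have bg0 : 0 <= beta / gamma by rewrite divr_ge0 // ltW.
apply: le_trans (ler_norm_sum _ _ _) _.
apply: le_trans (_ : (\sum_(m < d.+1) (U * V)`_m) * (beta / gamma) ^+ K.+1 <= _); last first.
  by rewrite ler_wpM2r ?exprn_ge0.
rewrite big_ord_recl mulrDl big_distrl -[X in X <= _]add0r lerD //.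
  by rewrite mulr_ge0 ?exprn_ge0.
apply: ler_sum => m _; rewrite lift0 [_ * _]/=.
case: (leqP m.+1 K) => mK.
  by rewrite fHlow //= mul0r normr0 mulr_ge0 ?exprn_ge0.
apply: le_trans (_ : (U * V)`_m.+1 * (beta / gamma) ^+ m.+1 <= _); last first.
  rewrite ler_wpM2l // ler_wiXn2l //.
  by rewrite ler_pdivrMr // mul1r.
rewrite normrM normrX normfV.
apply: le_trans (_ : `|(f * H)`_m.+1| / beta ^+ m.+1 * (beta / gamma) ^+ m.+1 <= _); last first.
  by rewrite ler_wpM2r ?exprn_ge0.
rewrite expr_div_n mulrA mulfVK ?gt_eqF // ler_wpM2l // -exprVn.
rewrite lerXn2r ?nnegrE ?invr_ge0 ?(ltW g0) //.
by rewrite lef_pV2 ?posrE // (lt_le_trans g0).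
Qed.
End PowerSums.

Section Triangular.
Variables (F : comNzRingType) (n : nat).

Lemma trig_mulmx (A B : 'M[F]_n) : is_trig_mx A -> is_trig_mx B ->
  is_trig_mx (A *m B) /\ (forall i, (A *m B) i i = A i i * B i i).
Proof.
move=> /is_trig_mxP tA /is_trig_mxP tB; split.
  apply/is_trig_mxP => i j ij; rewrite mxE big1 // => l _.
  case: (ltnP i l) => il; first by rewrite tA ?mul0r.
  by rewrite (tB l j) ?mulr0 // (leq_ltn_trans il).
move=> i; rewrite mxE (bigD1 i) //= big1 ?addr0 // => l /eqP li.
case: (ltngtP i l) => [il|il|/val_inj eil]; first by rewrite tA ?mul0r.
  by rewrite tB ?mulr0.
by case: li.
Qed.

Lemma trig_exprmx (A : 'M[F]_n) k : is_trig_mx A ->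
  is_trig_mx (A ^+ k) /\ (forall i, (A ^+ k) i i = A i i ^+ k).
Proof.
move=> tA; elim: k => [|k [tk dk]].
  by rewrite expr0 scalar_mx_is_trig; split=> // i; rewrite mxE eqxx expr0.
have [t d] := trig_mulmx tA tk; rewrite exprS; split=> // i.
by rewrite [LHS]d dk exprS.
Qed.
End Triangular.

Section Spectrum.
Variables (C : numClosedFieldType) (n : nat) (A : 'M[C]_n) (L : seq C).
Hypothesis AL : char_poly A = \prod_(z <- L) ('X - z%:P).

(** Schur's triangularisation reduces traces of powers and [det (1 - z A)] to the diagonal entries,
    which are the eigenvalues with multiplicity. *)
Lemma trigonal_spectrum : exists2 T : 'M[C]_n, is_trig_mx T &
  exists2 P : 'M[C]_n, P \in unitmx & A = invmx P *m T *m P.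
Proof.
have [n0|n_gt0] := posnP n.
  exists 0; first by apply/is_trig_mxP => i; have := ltn_ord i; rewrite {2}n0.
  by exists 1%:M; rewrite ?unitmx1 //; apply/matrixP => i; have := ltn_ord i; rewrite {2}n0.
have [P /unitarymx_unit Pu] := Schur A n_gt0; rewrite /similar_to conjumx // => tT.
exists (P *m A *m invmx P) => //; exists P => //.
by rewrite !mulmxA mulVmx // mul1mx -mulmxA mulVmx // mulmx1.
Qed.

Let map_invmxK (P : 'M[C]_n) : P \in unitmx ->
  map_mx polyC (invmx P) *m map_mx polyC P = 1%:M
  /\ map_mx polyC P *m map_mx polyC (invmx P) = 1%:M.
Proof. by move=> Pu; rewrite -!map_mxM mulVmx // mulmxV // map_mx1. Qed.

Let diag_spectrum T P : is_trig_mx T -> P \in unitmx -> A = invmx P *m T *m P ->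
  perm_eq L [seq T i i | i <- enum 'I_n].
Proof.
move=> tT Pu AE; apply: prod_XsubC_eq; rewrite -AL big_map big_enum /=.
rewrite -(char_poly_trig tT) AE /char_poly /char_poly_mx.
have [iP Pi] := map_invmxK Pu.
have -> : 'X%:M - map_mx polyC (invmx P *m T *m P)
   = map_mx polyC (invmx P) *m ('X%:M - map_mx polyC T) *m map_mx polyC P.
  by rewrite mulmxBr mulmxBl !map_mxM scalar_mxC -(mulmxA 'X%:M) iP mulmx1.
by rewrite !det_mulmx mulrC mulrA -det_mulmx Pi det1 mul1r.
Qed.

Lemma mxtrace_expr_psum k : \tr (A ^+ k) = psum L k.
Proof.
have [T tT [P Pu AE]] := trigonal_spectrum.
rewrite /psum (perm_big _ (diag_spectrum tT Pu AE)) big_map big_enum /=.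
have -> : A ^+ k = invmx P *m T ^+ k *m P.
  elim: k => [|k IH]; first by rewrite !expr0 mulmx1 mulVmx.
  rewrite !exprS IH [in LHS]AE -![LHS]mulmxA -[RHS]mulmxA.
  by congr (_ *m _); rewrite -[in RHS]mulmxA; congr (_ *m _); rewrite !mulmxA mulmxV ?mul1mx.
rewrite mxtrace_mulC mulmxA mulmxV // mul1mx.
by have [_ d] := trig_exprmx k tT; apply: eq_bigr => i _; rewrite d.
Qed.

Lemma det_1BX_rev_poly : \det (1%:M - 'X *: map_mx polyC A) = rev_poly L.
Proof.
have [T tT [P Pu AE]] := trigonal_spectrum.
rewrite /rev_poly (perm_big _ (diag_spectrum tT Pu AE)) big_map big_enum /= AE.
have [iP Pi] := map_invmxK Pu.
have -> : 1%:M - 'X *: map_mx polyC (invmx P *m T *m P)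
   = map_mx polyC (invmx P) *m (1%:M - 'X *: map_mx polyC T) *m map_mx polyC P.
  by rewrite mulmxBr mulmxBl mulmx1 iP !map_mxM -scalemxAr -scalemxAl.
rewrite !det_mulmx mulrC mulrA -det_mulmx Pi det1 mul1r.
rewrite det_trig; last first.
  apply/is_trig_mxP => i j ij; rewrite !mxE (is_trig_mxP tT) // polyC0 mulr0 subr0.
  by case: eqP ij => // ->; rewrite ltnn.
by apply: eq_bigr => i _; rewrite !mxE eqxx mulrC mul_polyC.
Qed.
End Spectrum.

(** * Spectrum of the transition matrix *)

Section ModelSpectrum.
Variables (R : realType) (n N : nat) (a b : 'I_N -> 'I_n).
Local Notation od := (odeg a).
Local Notation rc := (real_complex R).

Definition model_mx (s : 'S_N) : 'M[R]_n :=
  \matrix_(u, v) (#|[set e | (a e == u) && (b (s e) == v)]|%:R / (od u)%:R).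

Hypothesis odeg_gt0 : forall u, (0 < od u)%N.
Hypothesis N_gt0 : (0 < N)%N.

Section Fixed.
Variable s : 'S_N.

Let U : 'M[R]_(n, N) := \matrix_(u, e) ((a e == u)%:R / (od u)%:R).
Let V : 'M[R]_(N, n) := \matrix_(e, v) (b (s e) == v)%:R.
Local Notation Q := (row_perm s (incid_mx R a b)).
Local Notation g := (\det (1%:M - 'X *: map_mx polyC (row_perm s (cincid_mx R a b)))).

Let modelE : model_mx s = U *m V.
Proof.
apply/matrixP => u v; rewrite !mxE -sum1dep_card natr_sum big_distrl /= big_mkcond.
apply: eq_bigr => e _; rewrite !mxE.
by case: (a e == u); case: (b (s e) == v); rewrite /= ?mulr1 ?mul0r ?mulr0.
Qed.

Let incidE : Q = V *m U.
Proof.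
apply/matrixP => e e'; rewrite !mxE (bigD1 (b (s e))) //= !mxE eqxx mul1r.
rewrite big1 ?addr0 => [|v vn]; last by rewrite !mxE eq_sym (negPf vn) mul0r.
by rewrite eq_sym; case: eqP => [<-|_]; rewrite ?mul0r.
Qed.

Lemma mxtrace_model k : \tr (model_mx s ^+ k.+1) = \tr (Q ^+ k.+1).
Proof.
have E m : model_mx s ^+ m.+1 = U *m Q ^+ m *m V.
  elim: m => [|m IH]; first by rewrite expr1 expr0 mulmx1 modelE.
  have -> : Q ^+ m.+1 = V *m U *m Q ^+ m by rewrite exprS -incidE.
  by rewrite exprS IH modelE -[LHS]/(U *m V *m _) !mulmxA.
by rewrite E -mulmxA mxtrace_mulC -mulmxA -incidE exprSr.
Qed.

Let det_scale_mulC m p (M1 : 'M[R]_(m, p)) (M2 : 'M[R]_(p, m)) :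
  \det (1%:M - 'X *: map_mx polyC (M1 *m M2))
  = \det (1%:M - 'X *: map_mx polyC (M2 *m M1)).
Proof.
by rewrite !map_mxM scalemxAl -mulNmx det_add1_mulmxC mulmxN -scalemxAr.
Qed.

Lemma det_model : \det (1%:M - 'X *: map_mx polyC (model_mx s)) = (1 - 'X) * g.
Proof.
rewrite modelE det_scale_mulC -incidE.
pose J : 'M[R]_N := const_mx N%:R^-1.
have J_split : J = (const_mx 1 : 'cV_N) *m (const_mx N%:R^-1 : 'rV_N).
  by apply/matrixP => i j; rewrite !mxE big_ord1 !mxE mul1r.
have N0 : N%:R != 0 :> R by rewrite pnatr_eq0 -lt0n.
have -> : 1 - 'X = \det (1%:M - 'X *: map_mx polyC J) :> {poly R}.
  rewrite J_split det_scale_mulC det_mx11 !mxE eqxx; congr (_ - _).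
  under eq_bigr do rewrite !mxE mulr1.
  by rewrite sumr_const card_ord -[_ *+ N]mulr_natr mulVf // mulr1.
rewrite mulrC -det_mulmx; congr (\det _).
(* [(1 - z S C)(1 - z J) = 1 - z (S C + J)] because [S C J = 0], and [S C + J = S B] because
   permuting the rows of [J] does not change it. *)
have CJ : row_perm s (cincid_mx R a b) *m J = 0.
  apply/matrixP => i j; rewrite mxE [RHS]mxE.
  rewrite (eq_bigr (fun e => cincid_mx R a b (s i) e * N%:R^-1)) => [|e _].
    by rewrite -big_distrl /= cincid_row // mul0r.
  by rewrite [row_perm _ _ _ _]mxE [J _ _]mxE.
have QE : Q = row_perm s (cincid_mx R a b) + J.
  by apply/matrixP => i j; rewrite !mxE subrK.
rewrite mulmxBl !mulmxBr !mul1mx mulmx1 -scalemxAl -scalemxAr -map_mxM CJ.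
rewrite map_mx0 !scaler0 subr0 QE map_mxD scalerDr opprD addrA.
by rewrite [in RHS]addrAC.
Qed.

Local Notation L := (eigenvalues (model_mx s)).

Lemma char_poly_eigenvalues (A : 'M[R]_n) :
  char_poly (map_mx rc A) = \prod_(z <- eigenvalues A) ('X - z%:P).
Proof.
rewrite /eigenvalues (perm_big _ (introT permPl (perm_sort _ _))) /=.
case: closed_field_poly_normal => r /= rE.
by rewrite {1}rE (monicP (char_poly_monic _)) scale1r.
Qed.

Let rev_poly_eigenvalues : rev_poly L = (1 - 'X) * map_poly rc g.
Proof.
rewrite -(det_1BX_rev_poly (char_poly_eigenvalues _)).
have -> : 1 - 'X = map_poly rc (1 - 'X) :> {poly R[i]}.
  by rewrite rmorphB rmorph1 /= map_polyX.
rewrite -rmorphM -det_model -det_map_mx; congr (\det _).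
apply/matrixP => i j; rewrite !mxE. rewrite [RHS]rmorphB.
congr (_ - _); first by rewrite [RHS]rmorph_nat.
by rewrite [RHS]rmorphM /= map_polyX map_polyC.
Qed.

Lemma mem1_eigenvalues : 1 \in L.
Proof.
have : (rev_poly L).[1] == 0.
  by rewrite rev_poly_eigenvalues hornerM !hornerE subrr mul0r.
rewrite /rev_poly horner_prod prodf_seq_eq0 => /hasP[x xL].
by rewrite !hornerE subr_eq0 => /eqP ->.
Qed.

(** [rem] deletes one copy of 1 only: the eigenvalue 1 may be multiple, and any further copy counts
    as [lambda2]. *)
Lemma rev_poly_rem1 : rev_poly (rem 1 L) = map_poly rc g.
Proof.
have X1 : 1 - 'X != 0 :> {poly R[i]}.
  by rewrite -opprB oppr_eq0 polyXsubC_eq0.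
apply: (mulfI X1); rewrite -rev_poly_eigenvalues.
by rewrite /rev_poly [in RHS](perm_big _ (perm_to_rem mem1_eigenvalues)) big_cons scale1r.
Qed.

Lemma psum_rem1 k : psum (rem 1 L) k.+1 = (\tr (Q ^+ k.+1) - 1)%:C%C.
Proof.
have -> : psum (rem 1 L) k.+1 = psum L k.+1 - 1.
  by rewrite /psum (perm_big _ (perm_to_rem mem1_eigenvalues)) big_cons expr1n addrC addKr.
rewrite -(mxtrace_expr_psum (char_poly_eigenvalues _)) -mxtrace_model rmorphB rmorph1.
congr (_ - _); rewrite -[RHS]/(rc _) -trace_map_mx; congr (\tr _).
elim: k => [|k IH]; first by rewrite !expr1.
by rewrite exprS [in RHS]exprS map_mxM IH.
Qed.

Lemma lambda2_mem (gamma : R) : 0 <= gamma ->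
  (gamma%:C%C < `|lambda2 (model_mx s)|) ->
  exists2 x, x \in rem 1 L & gamma%:C%C <= `|x|.
Proof.
move=> g0; rewrite /lambda2.
have : sorted (fun x y : R[i] => `|y| <= `|x|) L.
  apply: sort_sorted => x y; exact: real_leVge (normr_real y) (normr_real x).
case: L => [|x0 [|x1 L']] /=.
- by rewrite normr0 ltcR ltNge g0.
- by rewrite normr0 ltcR ltNge g0.
(* [rem 1] deletes [x0] only if it equals 1, and then [x1] remains; otherwise [x0] survives, with
   modulus at least that of [x1]. So 1 need not be known to come first. *)
move=> /andP[x10 _] /ltW g1; case: eqP => [_|_].
  by exists x1; rewrite ?mem_head.
by exists x0; rewrite ?mem_head // (le_trans g1).
Qed.

Lemma lambda2_large (beta gamma A : R) (B K : nat) :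
  0 < beta -> beta <= gamma -> (0 < B)%N ->
  \sum_(i < N.+1) `|g`_i| / beta ^+ i <= A ->
  \sum_(k < K) `|\tr (Q ^+ k.+1) - 1| / beta ^+ k.+1 <= B%:R ->
  (gamma%:C%C < `|lambda2 (model_mx s)|) ->
  1 <= A * (K.+1 * B ^ B)%:R * (beta / gamma) ^+ K.+1.
Proof.
move=> b0 bg B0 HA HB lam; have g0 : 0 < gamma := lt_le_trans b0 bg.
have [x xL gx] := lambda2_mem (ltW g0) lam.
have normC (y : R) : `|y%:C%C| = (`|y|)%:C%C by rewrite normc_def /= expr0n addr0 sqrtr_sqr.
(* No index set has more than [N] elements, so the coefficients vanish beyond degree [N]. *)
have sg : (size g <= N.+1)%N.
  apply/leq_sizeP => k Nk; rewrite coef_det_1BX big_pred0 ?mulr0 // => J.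
  by apply/negbTE; rewrite neq_ltn (leq_ltn_trans (max_card _)) ?card_ord.
rewrite -lecR rmorph1 !(rmorphM, rmorphXn, fmorphV, rmorph_nat) /=.
apply: (@root_lt _ (rem 1 L) (rc beta) (rc gamma) (rc A) B K x) => //.
- by rewrite ltcR.
- by rewrite ltcR.
- by rewrite lecR.
- rewrite rev_poly_rem1 size_map_poly.
  rewrite (eq_bigr (fun i : 'I_(size g) => rc (`|g`_i| / beta ^+ i))) => [|i _]; last first.
    by rewrite coef_map normC rmorphM fmorphV rmorphXn.
  rewrite -rmorph_sum lecR; apply: le_trans HA.
  rewrite -(big_mkord predT (fun i => `|g`_i| / beta ^+ i)).
  rewrite -(big_mkord predT (fun i => `|g`_i| / beta ^+ i)).
  rewrite (big_cat_nat (n := size g) (p := N.+1)) //= lerDl sumr_ge0 // => i _.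
  by rewrite divr_ge0 // exprn_ge0 // ltW.
- rewrite (eq_bigr (fun k : 'I_K => rc (`|\tr (Q ^+ k.+1) - 1| / beta ^+ k.+1)))
    => [|k _]; last first.
    by rewrite psum_rem1 normC rmorphM fmorphV rmorphXn.
  by rewrite -rmorph_sum -(rmorph_nat rc) lecR.
Qed.
End Fixed.
End ModelSpectrum.

(** * Elementary inequalities and Markov's bound *)

Lemma sum_arith_geom_le (R : realFieldType) (x : R) m : 0 <= x -> x <= 1 ->
  (1 - x) ^+ 2 * \sum_(i < m) i.+1%:R * x ^+ i <= 1.
Proof.
move=> x0 x1.
have -> : (1 - x) ^+ 2 * \sum_(i < m) i.+1%:R * x ^+ i
    = 1 - x ^+ m * (1 + m%:R * (1 - x)).
  elim: m => [|m IH]; first by rewrite big_ord0 mulr0 expr0 mul0r addr0 mul1r subrr.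
  by rewrite big_ord_recr /= mulrDr IH [x ^+ m.+1]exprS -[m.+1%:R]natr1; ring.
rewrite gerBl mulr_ge0 ?exprn_ge0 // addr_ge0 // mulr_ge0 // subr_ge0 //.
Qed.

Lemma bernoulli_ineq (R : realFieldType) (h : R) m : 0 <= h -> m%:R * h <= (1 + h) ^+ m.
Proof.
move=> h0; have H : 1 + m%:R * h <= (1 + h) ^+ m.
  elim: m => [|m IH]; first by rewrite mul0r addr0 expr0.
  have h1 : 0 <= 1 + h by rewrite addr_ge0.
  rewrite exprS; apply: le_trans (ler_wpM2l h1 IH).
  rewrite -[m.+1%:R]natr1 -subr_ge0.
  set q := _ - _; have -> : q = m%:R * h ^+ 2 by rewrite /q; ring.
  by rewrite mulr_ge0 // sqr_ge0.
by apply: le_trans H; rewrite lerDr.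
Qed.

Lemma arith_geom_small (R : realType) (c x : R) : 0 <= c -> 0 < x -> x < 1 ->
  exists K : nat, c * K.+1%:R * x ^+ K.+1 < 1.
Proof.
move=> c0 x0 x1; pose h := x^-1 - 1.
have h0 : 0 < h by rewrite subr_gt0 invf_gt1.
pose m := Num.Def.archi_bound (2 * c / h ^+ 2).
have mP : 2 * c / h ^+ 2 < m.+1%:R.
  have c2 : 0 <= 2 * c / h ^+ 2 by rewrite divr_ge0 ?sqr_ge0 // mulr_ge0.
  by apply: lt_le_trans (archi_boundP c2) _; rewrite ler_nat.
have xX : 0 < x ^+ m.+1 by rewrite exprn_gt0.
have B := bernoulli_ineq m.+1 (ltW h0).
have xh : x * (1 + h) = 1 by rewrite /h addrC subrK mulfV ?gt_eqF.
have mhx : m.+1%:R * h * x ^+ m.+1 <= 1.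
  apply: le_trans (ler_wpM2r (ltW xX) B) _.
  by rewrite -exprMn mulrC [x * _]mulrC mulrC xh expr1n.
(* An even exponent [2 (m + 1)] allows squaring Bernoulli's bound [(m + 1) h x^(m+1) <= 1]; one
   factor [m + 1] then remains to beat the linear growth. *)
exists (m.+1.*2).-1; rewrite prednK // -muln2 natrM exprM.
set M : R := m.+1%:R; have m0 : 0 < M by rewrite ltr0n.
set y := x ^+ m.+1; have h2 : 0 < h ^+ 2 by rewrite exprn_gt0.
move: mP; rewrite ltr_pdivrMr // -/M => mP.
have sq : (M * h * y) ^+ 2 <= 1.
  rewrite expr_le1 //; apply: mulr_ge0; last exact: ltW.
  by rewrite mulr_ge0 // ltW.
have Mh : 0 < M * h ^+ 2 by rewrite mulr_gt0.
rewrite -(ltr_pM2l Mh) mulr1; apply: le_lt_trans mP.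
have -> : M * h ^+ 2 * (c * (M * 2) * y ^+ 2) = 2 * c * (M * h * y) ^+ 2 by ring.
by rewrite ler_piMr // mulr_ge0.
Qed.

Lemma avg_markov2 (R : realFieldType) N (P : pred 'S_N) (X Y : 'S_N -> R) A B :
  0 < A -> 0 < B -> (forall s, 0 <= X s) -> (forall s, 0 <= Y s) ->
  (forall s, P s -> X s <= A -> Y s <= B -> False) ->
  avg (fun s => (P s)%:R) <= avg X / A + avg Y / B.
Proof.
move=> A0 B0 X0 Y0 H; rewrite ![avg _ / _]mulrC -!avgZ -avgD; apply: avg_le => s.
have XA : 0 <= A^-1 * X s by rewrite mulr_ge0 ?invr_ge0 ?(ltW A0).
have YB : 0 <= B^-1 * Y s by rewrite mulr_ge0 ?invr_ge0 ?(ltW B0).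
case Ps: (P s); last by rewrite addr_ge0.
case: (leP (X s) A) => hA.
  case: (leP (Y s) B) => hB; first by case: (H s Ps hA hB).
  apply: le_trans (_ : B^-1 * Y s <= _); last by rewrite lerDr.
  by rewrite ler_pdivlMl // mulr1 ltW.
apply: le_trans (_ : A^-1 * X s <= _); last by rewrite lerDl.
by rewrite ler_pdivlMl // mulr1 ltW.
Qed.

(** * Tail bound *)

Section Tail.
Variable R : realType.

Section Averages.
Variables (n N : nat) (a b : 'I_N -> 'I_n) (D : nat) (r beta theta S delta : R).
Hypothesis odeg_gt0 : forall u, (0 < odeg a u)%N.
Hypothesis odeg_le : forall u, (odeg a u <= D)%N.
Hypothesis ideg_le : forall u, (ideg b u <= D)%N.
Hypothesis N_gt0 : (0 < N)%N.
Hypothesis delta_gt0 : 0 < delta.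
Hypothesis r_ge : delta^-1 <= r.
Hypothesis ratio_le : \sum_u (ideg b u)%:R / (odeg a u)%:R <= N%:R * r ^+ 2.
Hypothesis wt_le : forall x, wt R a x <= r.
Hypothesis beta_ge : r <= beta.
Hypothesis theta_ge : r / beta <= theta.
Hypothesis theta_lt1 : theta < 1.
Hypothesis S_def : S = ((1 - theta) ^+ 2)^-1.

Local Notation Q s := (row_perm s (incid_mx R a b)).
Local Notation g s := (\det (1%:M - 'X *: map_mx polyC (row_perm s (cincid_mx R a b)))).

Let r0 : 0 < r. Proof. by rewrite (lt_le_trans _ r_ge) // invr_gt0. Qed.
Let beta0 : 0 < beta. Proof. exact: lt_le_trans beta_ge. Qed.
Let theta0 : 0 <= theta.
Proof. by apply: le_trans theta_ge; rewrite divr_ge0 // ltW. Qed.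
Let t := (\sum_u (ideg b u)%:R / (odeg a u)%:R) / N%:R : R.
Let N0 : (0 : R) < N%:R. Proof. by rewrite ltr0n. Qed.
Let t_def : \sum_u (ideg b u)%:R / (odeg a u)%:R = N%:R * t.
Proof. by rewrite /t mulrC divfK ?gt_eqF. Qed.
Let t_le : t <= r ^+ 2.
Proof. by rewrite /t ler_pdivrMr // mulrC. Qed.
Let t_ge0 : 0 <= t.
Proof. by rewrite /t divr_ge0 // sumr_ge0 // => u _; rewrite divr_ge0. Qed.

Let sum_theta m : \sum_(i < m) i.+1%:R * theta ^+ i <= S.
Proof.
have th : 0 < (1 - theta) ^+ 2 by rewrite exprn_gt0 // subr_gt0.
by rewrite S_def -[_^-1]mulr1 ler_pdivlMl // sum_arith_geom_le // ltW.
Qed.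

Let theta_pow i : r ^+ i / beta ^+ i <= theta ^+ i.
Proof.
by rewrite -expr_div_n lerXn2r ?nnegrE // divr_ge0 // ltW.
Qed.

(** The same quadratic bound on [|u|] as for the traces, at scale [r^i]; it gives
    [(i + 2) / 2 <= i + 1]. *)
Let avg_coef i : avg (fun s => `|(g s)`_i|) <= i.+1%:R * r ^+ i.
Proof.
have ri : 0 < r ^+ i by rewrite exprn_gt0.
have sq : avg (fun s => (g s)`_i ^+ 2) <= i.+1%:R * (r ^+ i * r ^+ i).
  have H := sum_sqr_coef_le odeg_gt0 N_gt0 t_def i.
  have f0 : (0 : R) < N`!%:R by rewrite ltr0n fact_gt0.
  rewrite /avg ler_pdivrMl //; apply: le_trans H _.
  rewrite mulrAC [X in _ <= X]mulrC ler_wpM2r // ler_wpM2l //.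
  by rewrite -exprD addnn -mul2n exprM lerXn2r ?nnegrE ?sqr_ge0.
apply: le_trans (_ : avg (fun s => 2^-1 * r ^- i * (g s)`_i ^+ 2 + 2^-1 * r ^+ i) <= _).
  apply: avg_le => s; set u := (g s)`_i; rewrite -[u ^+ 2]real_normK ?num_real // -subr_ge0.
  set q := _ - _; have -> : q = 2^-1 * r ^- i * (`|u| - r ^+ i) ^+ 2.
    by rewrite /q; field; rewrite gt_eqF.
  by rewrite mulr_ge0 ?sqr_ge0 // mulr_ge0 ?invr_ge0 // ltW.
rewrite avgD avgZ avg_cst; have h0 : 0 <= 2^-1 * r ^- i by rewrite mulr_ge0 ?invr_ge0 // ltW.
apply: le_trans (lerD (ler_wpM2l h0 sq) (lexx _)) _.
set x := r ^+ i; set q := _ + _; have -> : q = 2^-1 * (i.+1%:R + 1) * x.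
  by rewrite /q; field; rewrite gt_eqF.
rewrite ler_wpM2r ?(ltW ri) //; have : (1 : R) <= i.+1%:R by rewrite ler1n.
lra.
Qed.

Lemma avg_sum_coef_le m : avg (fun s => \sum_(i < m) `|(g s)`_i| / beta ^+ i) <= S.
Proof.
rewrite avg_sum; apply: le_trans (sum_theta m); apply: ler_sum => i _.
under eq_avg do rewrite mulrC.
rewrite avgZ; apply: le_trans (ler_wpM2l _ (avg_coef i)) _.
  by rewrite invr_ge0 exprn_ge0 // ltW.
rewrite mulrCA ler_wpM2l // mulrC; exact: theta_pow.
Qed.

Variable K : nat.
Hypothesis N_ge : ((K.*2 * K.*2).*2 <= N)%N.
Hypothesis N_ge_cst : \sum_(k < K)
  (trace_cst D k.+1)%:R * (1 + delta ^+ k.+1) * delta ^+ k.+1 <= N%:R.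

(** [4 S] comes from [3 (k + 1) + 1 <= 4 (k + 2)], and the final 1 from the [1/N] errors. Since
    [r >= 1 / delta], negative powers of [r] and [beta] are at most powers of [delta], so the
    required size of [N] does not depend on [r]. *)
Lemma avg_sum_trace_le :
  avg (fun s => \sum_(k < K) `|\tr (Q s ^+ k.+1) - 1| / beta ^+ k.+1) <= 4 * S + 1.
Proof.
have bi : beta^-1 <= delta.
  by rewrite -[delta]invrK lef_pV2 ?posrE ?invr_gt0 // (le_trans r_ge).
have ri : r^-1 <= delta by rewrite -[delta]invrK lef_pV2 ?posrE ?invr_gt0.
rewrite avg_sum; apply: le_trans (_ : \sum_(k < K) (4 * (k.+2%:R * theta ^+ k.+1)
   + N%:R^-1 * ((trace_cst D k.+1)%:R * (1 + delta ^+ k.+1) * delta ^+ k.+1)) <= _).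
  apply: ler_sum => k _; under eq_avg do rewrite mulrC.
  rewrite avgZ.
  have Nk : ((k.+1.*2 * k.+1.*2).*2 <= N)%N.
    by apply: leq_trans N_ge; rewrite leq_double leq_mul // leq_double ltn_ord.
  have H := avg_trace_deviation odeg_gt0 odeg_le ideg_le N_gt0 t_def r0 t_le wt_le Nk.
  have bk : 0 <= (beta ^+ k.+1)^-1 by rewrite invr_ge0 exprn_ge0 // ltW.
  have pow_le x : 0 < x -> x^-1 <= delta -> x ^- k.+1 <= delta ^+ k.+1.
    by move=> x0 xd; rewrite -exprVn lerXn2r ?nnegrE ?invr_ge0 ?(ltW x0) // ltW.
  apply: le_trans (ler_wpM2l bk H) _; rewrite mulrDr; apply: lerD.
    rewrite [X in X <= _]mulrCA [X in _ <= X]mulrA; apply: ler_pM.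
    - by rewrite ler0n.
    - by rewrite mulr_ge0 // exprn_ge0 // ltW.
    - by rewrite -[4 * _](natrM R 4) ler_nat (mulnDl 3 1) leq_add // leq_mul.
    - by rewrite mulrC theta_pow.
  set c : R := (trace_cst D k.+1)%:R; set x := r ^- k.+1; set y := beta ^- k.+1.
  have -> : y * (c * (1 + x) / N%:R) = N%:R^-1 * (c * (1 + x) * y) by ring.
  have c0 : 0 <= c by rewrite ler0n.
  have x0 : 0 <= x by rewrite invr_ge0 exprn_ge0 // ltW.
  rewrite ler_wpM2l ?invr_ge0 //; apply: ler_pM => //.
  - by rewrite mulr_ge0 // addr_ge0.
  - by rewrite ler_wpM2l // lerD2l pow_le.
  - by rewrite pow_le.
rewrite big_split /= -!big_distrr /= lerD //.
  rewrite ler_wpM2l //; apply: le_trans (sum_theta K.+1).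
  by rewrite [X in _ <= X]big_ord_recl /= expr0 mulr1 lerDr.
by rewrite ler_pdivrMl // mulr1.
Qed.
End Averages.

Theorem model_tail (delta eps eta : R) (D : nat) :
  1 <= delta -> 0 < eps -> 0 < eta -> exists N0 : nat,
  forall (n N : nat) (a b : 'I_N -> 'I_n) (r : R),
    (N0 <= N)%N -> (0 < N)%N ->
    (forall u, 0 < odeg a u)%N -> (forall u, odeg a u <= D)%N ->
    (forall u, ideg b u <= D)%N ->
    delta^-1 <= r -> r <= 1 ->
    \sum_u (ideg b u)%:R / (odeg a u)%:R <= N%:R * r ^+ 2 ->
    (forall x, wt R a x <= r) ->
  avg (fun s : 'S_N => ((r + eps)%:C%C < `|lambda2 (model_mx R a b s)|)%R%:R) <= eta.
Proof.
(* [theta] and [q] are the ratios [r / beta] and [beta / gamma] at [r = 1], their largest values for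
   [r <= 1]; so no constant depends on [r]. [A] and [B] make each of the two Markov bounds at most
   [eta / 2]. *)
move=> d1 e0 n0; pose theta := (1 + eps / 2)^-1; pose q := (1 + eps / 2) / (1 + eps).
pose S := ((1 - theta) ^+ 2)^-1; pose A := 2 * S / eta.
have h0 : 0 < eps / 2 by rewrite divr_gt0.
have th1 : theta < 1 by rewrite invf_lt1 ?ltrDl // addr_gt0.
have S0 : 0 < S by rewrite invr_gt0 exprn_gt0 // subr_gt0.
have A0 : 0 < A by rewrite divr_gt0 // mulr_gt0.
pose B := (Num.Def.archi_bound (2 * (4 * S + 1) / eta)).+1.
have BP : 2 * (4 * S + 1) / eta <= B%:R.
  have c0 : 0 <= 2 * (4 * S + 1) / eta.
    by rewrite divr_ge0 ?(ltW n0) // mulr_ge0 // addr_ge0 // mulr_ge0 // ltW.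
  apply: le_trans (ltW (archi_boundP c0)) _.
  by rewrite ler_nat.
have q0 : 0 < q by rewrite divr_gt0 // addr_gt0.
have q1 : q < 1.
  rewrite ltr_pdivrMr ?addr_gt0 // mul1r ltrD2l ltr_pdivrMr //.
  by rewrite mulr_natr mulr2n ltrDl.
have AB0 : 0 <= A * (B ^ B)%:R by rewrite mulr_ge0 // ltW.
(* [A] and [B] depend on [S] and [eta] only, so [K] may be chosen after them. *)
have [K KP] := arith_geom_small AB0 q0 q1.
pose G := \sum_(k < K) (trace_cst D k.+1)%:R * (1 + delta ^+ k.+1) * delta ^+ k.+1.
have d0 : 0 < delta by apply: lt_le_trans d1.
have G0 : 0 <= G.
  apply: sumr_ge0 => k _; have dk : 0 <= delta ^+ k.+1 by rewrite exprn_ge0 // ltW.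
  by rewrite mulr_ge0 // mulr_ge0 // addr_ge0.
exists (maxn (K.*2 * K.*2).*2 (Num.Def.archi_bound G)).
move=> n N a b r; rewrite geq_max => /andP[NK NG] N0 o0 oD iD rd r1 ratio wr.
pose beta := r + eps / 2.
have r0 : 0 < r by apply: lt_le_trans rd; rewrite invr_gt0.
have b0 : 0 < beta by rewrite addr_gt0.
have g0 : 0 < r + eps by rewrite addr_gt0.
have rb : r <= beta by rewrite lerDl ltW.
have bth : r / beta <= theta.
  rewrite ler_pdivrMr // mulrC ler_pdivlMr ?addr_gt0 // mulrDr mulr1 lerD2l.
  by rewrite ler_piMl // ltW.
have bq : beta / (r + eps) <= q.
  rewrite ler_pdivrMr // mulrAC ler_pdivlMr ?addr_gt0 // -subr_ge0.
  have -> : (1 + eps / 2) * (r + eps) - beta * (1 + eps) = eps / 2 * (1 - r).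
    by rewrite /beta; field.
  by rewrite mulr_ge0 ?subr_ge0 // ltW.
have NG' : G <= N%:R.
  by apply: le_trans (ltW (archi_boundP G0)) _; rewrite ler_nat.
have B0 : (0 : R) < B%:R by rewrite ltr0n.
pose X (s : 'S_N) := \sum_(i < N.+1)
  `|(\det (1%:M - 'X *: map_mx polyC (row_perm s (cincid_mx R a b))))`_i| / beta ^+ i.
pose Y (s : 'S_N) := \sum_(k < K)
  `|\tr (row_perm s (incid_mx R a b) ^+ k.+1) - 1| / beta ^+ k.+1.
have bX i : 0 <= beta ^+ i by rewrite exprn_ge0 // ltW.
apply: le_trans (avg_markov2 (X := X) (Y := Y) A0 B0 _ _ _) _.
- by move=> s; apply: sumr_ge0 => i _; rewrite divr_ge0.
- by move=> s; apply: sumr_ge0 => i _; rewrite divr_ge0.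
- move=> s lam XA YB.
  have bg : beta <= r + eps by rewrite lerD2l ler_pdivrMr // ler_peMr ?ler1n // ltW.
  have := lambda2_large o0 N0 b0 bg (ltn0Sn _) XA YB lam.
  apply/negP; rewrite -ltNge; apply: le_lt_trans KP.
  rewrite [(K.+1 * B ^ B)%:R](natrM R) [K.+1%:R * _]mulrC mulrA.
  apply: ler_wpM2l; first exact: mulr_ge0.
  apply: lerXn2r => //; rewrite nnegrE ?(ltW q0) //.
  by rewrite divr_ge0 // ltW.
have XE := avg_sum_coef_le o0 N0 d0 rd ratio rb bth th1 (erefl S) N.+1.
have YE := avg_sum_trace_le o0 oD iD N0 d0 rd ratio wr rb bth th1 (erefl S) NK NG'.
apply: le_trans (_ : S / A + (4 * S + 1) / B%:R <= _).
  by rewrite lerD // ler_wpM2r // invr_ge0 ltW.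
have SA : S / A = eta / 2 by rewrite /A; field; rewrite !gt_eqF.
have SB : (4 * S + 1) / B%:R <= eta / 2.
  by move: BP; rewrite !ler_pdivrMr //; lra.
by rewrite SA; lra.
Qed.
End Tail.

(** * From matchings of half-edges to permutations *)

Lemma card_half_edges n (d : 'I_n -> nat) : #|half_edges d| = (\sum_(i < n) d i)%N.
Proof.
rewrite card_tagged sumnE big_map big_enum /=.
by apply: eq_bigr => i _; rewrite card_ord.
Qed.

Lemma card_half_edges_at n (d : 'I_n -> nat) u :
  #|[set h : half_edges d | tag h == u]| = d u.
Proof.
rewrite -sum1dep_card.
transitivity (\sum_(i < n | i == u) \sum_(j < d i) 1)%N.
  rewrite (sig_big_dep _ (fun=> predT)) /=.
  by apply: eq_bigl => h; rewrite andbT.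
by rewrite big_pred1_eq sum1_card card_ord.
Qed.

Section Matchings.
Variables (R : realType) (n N : nat) (dp dm : 'I_n -> nat).
Variables (gH : 'I_N -> half_edges dp) (gT : 'I_N -> half_edges dm).
Variables (gH' : half_edges dp -> 'I_N) (gT' : half_edges dm -> 'I_N).
Hypotheses (gHK : cancel gH gH') (gHK' : cancel gH' gH).
Hypotheses (gTK : cancel gT gT') (gTK' : cancel gT' gT).

Let a e := tag (gH e).
Let b f := tag (gT f).
Let toM (p : 'S_N) : {ffun half_edges dp -> half_edges dm} := [ffun h => gT (p (gH' h))].

Let toM_inj : injective toM.
Proof.
move=> p q /ffunP pq; apply/permP => x; have := pq (gH x).
by rewrite !ffunE gHK => /(can_inj gTK).
Qed.

Let toM_img : matchings dp dm = [set toM p | p in 'S_N].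
Proof.
apply/setP => s; rewrite inE; apply/asboolP/imsetP => [sB|[p _ ->]].
  have fI : injective (fun x => gT' (s (gH x))).
    move=> x y /(can_inj gTK') /(bij_inj sB) ; exact: can_inj gHK _ _.
  exists (perm fI) => //; apply/ffunP => h.
  by rewrite ffunE permE gTK' gHK'.
exists (fun f => gH (p^-1 (gT' f))%g) => x; rewrite ffunE.
  by rewrite gTK permK gHK'.
by rewrite gHK permKV gTK'.
Qed.

Lemma matching_prob_avg (P : pred {ffun half_edges dp -> half_edges dm}) :
  matching_prob R P = avg (fun p : 'S_N => (P (toM p))%:R).
Proof.
rewrite /matching_prob /avg toM_img card_imset // card_Sn mulrC; congr (_ * _).
rewrite -natr_sum; congr (_%:R).
have -> : [set s in [set toM p | p in 'S_N] | P s] = [set toM p | p in [set p | P (toM p)]].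
  apply/setP => s; rewrite !inE; apply/andP/imsetP => [[/imsetP[p _ ->] Pp]|[p]].
    by exists p; rewrite ?inE.
  by rewrite inE => Pp ->; rewrite imset_f.
rewrite card_imset // -sum1dep_card big_mkcond.
by apply: eq_bigr => p _; case: (P _).
Qed.

Lemma odeg_half u : odeg a u = dp u.
Proof.
rewrite -(card_half_edges_at dp u) /odeg -(card_imset _ (can_inj gHK)); apply: eq_card => h.
by rewrite -[h]gHK' (mem_imset _ _ (can_inj gHK)) !inE.
Qed.

Lemma ideg_half u : ideg b u = dm u.
Proof.
rewrite -(card_half_edges_at dm u) /ideg -(card_imset _ (can_inj gTK)); apply: eq_card => h.
by rewrite -[h]gTK' (mem_imset _ _ (can_inj gTK)) !inE.
Qed.

Lemma transition_model p : transition_mx R (toM p) = model_mx R a b p.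
Proof.
apply/matrixP => u v; rewrite !mxE odeg_half; congr (_%:R / _).
rewrite -(card_imset _ (can_inj gHK)); apply: eq_card => h.
by rewrite -[h]gHK' (mem_imset _ _ (can_inj gHK)) !inE ffunE gHK.
Qed.
End Matchings.

Theorem matching_tail (R : realType) (delta Delta eps eta : R) :
  2 <= delta -> 0 < eps -> 0 < eta -> exists N0 : nat,
  forall (n : nat) (dp dm : 'I_n -> nat), (N0 <= n)%N ->
    (forall i, delta <= (dp i)%:R <= Delta) -> (forall i, delta <= (dm i)%:R <= Delta) ->
    (\sum_(i < n) dp i)%N = (\sum_(i < n) dm i)%N ->
  matching_prob R (fun s : {ffun half_edges dp -> half_edges dm} =>
     (Num.max (rho dp dm R) delta^-1 + eps)%:C%C < `|lambda2 (transition_mx R s)|)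
  <= eta.
Proof.
move=> d2 e0 n0.
have d0 : 0 < delta by apply: lt_le_trans d2.
have d1 : 1 <= delta by apply: le_trans d2; rewrite ler1n.
(* A natural number bounding all degrees; [n >= 1], imposed next, ensures that there is at least one
   edge. *)
pose D := Num.Def.archi_bound `|Delta|.
have [N0 H] := model_tail D d1 e0 n0; exists (maxn 1 N0) => n dp dm.
rewrite geq_max => /andP[n1 nN0] hp hm sdm.
have dp0 i : (0 < dp i)%N.
  by rewrite -(ltr0n R); case/andP: (hp i) => h _; exact: lt_le_trans h.
have leD (d : 'I_n -> nat) : (forall i, delta <= (d i)%:R <= Delta) -> forall i, (d i <= D)%N.
  move=> hd i; rewrite -(ler_nat R); case/andP: (hd i) => _ h.
  apply: le_trans h (le_trans (ler_norm _) (ltW (archi_boundP (normr_ge0 _)))).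
pose N := #|half_edges dp|.
have NE : N = (\sum_(i < n) dp i)%N by exact: card_half_edges.
have NT : N = #|half_edges dm| by rewrite NE sdm card_half_edges.
have nN : (n <= N)%N.
  rewrite NE -[n in X in (X <= _)%N]card_ord -sum1_card.
  by apply: leq_sum => i _.
pose gH (x : 'I_N) : half_edges dp := enum_val x.
pose gT (x : 'I_N) : half_edges dm := enum_val (cast_ord NT x).
have gHK : cancel gH enum_rank by exact: enum_valK.
have gHK' : cancel enum_rank gH by exact: enum_rankK.
pose gT' (f : half_edges dm) := cast_ord (esym NT) (enum_rank f).
have gTK : cancel gT gT' by move=> x; rewrite /gT' /gT enum_valK cast_ordK.
have gTK' : cancel gT' gT by move=> x; rewrite /gT' /gT cast_ordKV enum_rankK.
pose a x := tag (gH x); pose b x := tag (gT x).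
have aE u : odeg a u = dp u by exact: odeg_half gHK gHK' u.
have bE u : ideg b u = dm u by exact: ideg_half gTK gTK' u.
rewrite (matching_prob_avg R gHK gHK' gTK gTK').
set r := Num.max _ _.
have rd : delta^-1 <= r by rewrite le_max lexx orbT.
have di1 : delta^-1 <= 1 by rewrite invf_le1.
have dp_inv i : (dp i)%:R^-1 <= delta^-1.
  by rewrite lef_pV2 ?posrE ?ltr0n //; case/andP: (hp i).
have N_gt0 : (0 < N)%N by apply: leq_trans nN.
have NR : (0 : R) < N%:R by rewrite ltr0n.
pose y : R := N%:R^-1 * \sum_(i < n) ((dm i)%:R / (dp i)%:R).
have y0 : 0 <= y.
  by rewrite mulr_ge0 ?invr_ge0 // sumr_ge0 // => i _; rewrite divr_ge0.
have rhoE : rho dp dm R = Num.sqrt y by rewrite /rho -NE.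
(* [d^- / d^+ <= d^-] and the in-degrees sum to [N]. Hence [rho <= 1], which the uniform constants
   of [model_tail] rely on. *)
have y1 : y <= 1.
  rewrite /y ler_pdivrMl // mulr1.
  apply: le_trans (_ : \sum_(i < n) (dm i)%:R <= _).
    by apply: ler_sum => i _; rewrite ler_piMr // (le_trans (dp_inv i)).
  by rewrite -natr_sum -sdm NE.
have r1 : r <= 1.
  by rewrite ge_max di1 andbT rhoE -[X in _ <= X]sqrtr1 ler_sqrt.
have yr : y <= r ^+ 2.
  have : rho dp dm R <= r by rewrite le_max lexx.
  by rewrite rhoE => h; rewrite -(sqr_sqrtr y0) lerXn2r ?nnegrE ?(le_trans _ h).
apply: le_trans (H n N a b r _ N_gt0 _ _ _ rd r1 _ _).
- apply: avg_le => p; rewrite (transition_model R gT gHK gHK' p).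
  by [].
- exact: leq_trans nN.
- by move=> u; rewrite aE.
- by move=> u; rewrite aE leD.
- by move=> u; rewrite bE leD.
- under eq_bigr do rewrite aE bE.
  by move: yr; rewrite /y ler_pdivrMl // mulrC.
- by move=> x; rewrite /wt aE; apply: le_trans (dp_inv _) rd.
Qed.

Local Open Scope classical_set_scope.
Local Open Scope ring_scope.
Local Open Scope complex_scope.

Theorem theorem1 (R : realType) (delta Delta : R)
    (dp dm : forall n : nat, 'I_n -> nat)
    (h2delta : 2 <= delta) (hdeltaDelta : delta <= Delta)
    (hdp : forall (n : nat) (i : 'I_n), delta <= (dp n i)%:R <= Delta)
    (hdm : forall (n : nat) (i : 'I_n), delta <= (dm n i)%:R <= Delta)
    (hsum : forall n : nat,
      (\sum_(i < n) dp n i)%N = (\sum_(i < n) dm n i)%N)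
    (eps : R) (heps : 0 < eps) :
  matching_prob R (fun s : {ffun half_edges (dp n) -> half_edges (dm n)} =>
      (Num.max (rho (dp n) (dm n) R) delta^-1 + eps)%:C
        < `|lambda2 (transition_mx R s)|) @[n --> \oo] --> (0 : R).
Proof.
apply/cvgrPdist_le => eta eta0.
have [N0 H] := matching_tail Delta h2delta heps eta0.
exists N0 => // n /= nN0; rewrite sub0r normrN ger0_norm; last exact: divr_ge0.
exact: H.
Qed.
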